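(* Let $\Lambda$ be an artin algebra, $n$ a positive integer, $\mathcal{M}$ an $n$-cluster tilting subcategory of $\mathrm{mod}\text{-}\Lambda$, and $X,Y$ in $\mathcal{M}$. (i) There is an isomorphism between $\underline{\mathcal{M}}(X,Y)$ and the group of natural transformations from $\mathrm{Ext}^n_\Lambda(Y,-)|_{\mathcal{M}}$ to $\mathrm{Ext}^n_\Lambda(X,-)|_{\mathcal{M}}$. (ii) There is an isomorphism between $\overline{\mathcal{M}}(X,Y)$ and the group of natural transformations from $\mathrm{Ext}^n_\Lambda(-,X)|_{\mathcal{M}}$ to $\mathrm{Ext}^n_\Lambda(-,Y)|_{\mathcal{M}}$.
   Context: $\mathrm{mod}\text{-}\Lambda$ is the category of finitely generated $\Lambda$-modules. A full additive subcategory $\mathcal{M}$ of $\mathrm{mod}\text{-}\Lambda$ is $n$-cluster tilting if it is functorially finite (every module has a right and a left $\mathcal{M}$-approximation), generating-cogenerating (every module is a quotient of an object of $\mathcal{M}$ and embeds in an object of $\mathcal{M}$), and $$\mathcal{M}=\{A: \mathrm{Ext}^i_\Lambda(\mathcal{M},A)=0,\ 0<i<n\}=\{A: \mathrm{Ext}^i_\Lambda(A,\mathcal{M})=0,\ 0<i<n\}.$$ $\underline{\mathcal{M}}(X,Y)$ (resp. $\overline{\mathcal{M}}(X,Y)$) is the group $\mathrm{Hom}_\Lambda(X,Y)$ modulo the morphisms factoring through a projective (resp. injective) $\Lambda$-module. $|_{\mathcal{M}}$ denotes restriction of a functor on $\mathrm{mod}\text{-}\Lambda$ to $\mathcal{M}$.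 *)

(* Defs.v *)
From HB Require Import structures.
From mathcomp Require Import all_boot all_algebra freeg.
From mathcomp Require Import boolp.

Set Implicit Arguments.
Unset Strict Implicit.
Unset Printing Implicit Defensive.

Import GRing.Theory.
Local Open Scope ring_scope.
Local Open Scope quotient_scope.

(* The ideals of [R] are the submodules of the regular module [R^o]. *)
Definition artinian (R : comNzRingType) : Prop :=
  forall I : nat -> {pred R^o},
    (forall i, GRing.submod_closed (I i)) ->
    (forall i, {subset I i.+1 <= I i}) ->
    exists N, forall i, (N <= i)%N -> I i =i I N.

Definition fin_gen (R : nzRingType) (A : lmodType R) : Prop :=
  exists (m : nat) (g : 'I_m -> A),
    forall a : A, exists c : 'I_m -> R, a = \sum_i c i *: g i.

Definition artin_algebra (k : comNzRingType) (L : algType k) : Prop :=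
  artinian k /\ @fin_gen k L.

Section Hom.
Variable R : nzRingType.
Implicit Types U V W : lmodType R.

Definition Hom U V : Type := {linear U -> V}.

HB.instance Definition _ U V := gen_eqMixin (Hom U V).
HB.instance Definition _ U V := gen_choiceMixin (Hom U V).

Lemma homP U V (f g : Hom U V) : f =1 g -> f = g.
Proof.
case: f g => [f [[fD] [fZ]]] [g [[gD] [gZ]]] /= /funext fg.
case: _ / fg in gD gZ *.
by rewrite (Prop_irrelevance gD fD) (Prop_irrelevance gZ fZ).
Qed.

Definition hom_zero U V : Hom U V := \0.
Definition hom_opp U V (f : Hom U V) : Hom U V := \- f.
Definition hom_add U V (f g : Hom U V) : Hom U V := f \+ g.

Fact hom_addA U V : associative (@hom_add U V).
Proof. by move=> f g h; apply: homP => x /=; rewrite addrA. Qed.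
Fact hom_addC U V : commutative (@hom_add U V).
Proof. by move=> f g; apply: homP => x /=; rewrite addrC. Qed.
Fact hom_add0 U V : left_id (hom_zero U V) (@hom_add U V).
Proof. by move=> f; apply: homP => x /=; rewrite add0r. Qed.
Fact hom_addN U V : left_inverse (hom_zero U V) (@hom_opp U V) (@hom_add U V).
Proof. by move=> f; apply: homP => x /=; rewrite addNr. Qed.

HB.instance Definition _ U V := GRing.isZmodule.Build (Hom U V)
  (@hom_addA U V) (@hom_addC U V) (@hom_add0 U V) (@hom_addN U V).

Definition mk_hom U V (f : U -> V) (lf : linear f) : Hom U V :=
  HB.pack f (GRing.isLinear.Build R U V *:%R f lf).

Definition id_hom U : Hom U U := idfun.
Definition comp_hom U V W (g : Hom V W) (f : Hom U V) : Hom U W := g \o f.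

End Hom.

Section Stable.
Variable R : nzRingType.
Implicit Types U V W P I : lmodType R.

Definition projective P : Prop :=
  forall U V (g : Hom U V) (f : Hom P V),
    (forall v, exists u, g u = v) -> exists h : Hom P U, g \o h =1 f.

Definition injective_module I : Prop :=
  forall U V (g : Hom U V) (f : Hom U I),
    injective g -> exists h : Hom V I, h \o g =1 f.

Definition factors_through (C : lmodType R -> Prop) U V (f : Hom U V) : Prop :=
  exists2 W, C W & exists (g : Hom U W) (h : Hom W V), f =1 h \o g.

Definition zero_module U : Prop := forall u : U, u = 0.

Fact pair_is_linear U V W (f : Hom U V) (g : Hom U W) :
  linear (fun u => (f u, g u)).
Proof. by move=> a u v; rewrite !linearP. Qed.
Definition pair_hom U V W (f : Hom U V) (g : Hom U W) : Hom U (V * W)%type :=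
  mk_hom (pair_is_linear f g).

Fact copair_is_linear U V W (f : Hom U W) (g : Hom V W) :
  linear (fun u : U * V => f u.1 + g u.2).
Proof.
by move=> a u v; rewrite !linearP /= scalerDr -!addrA; congr (_ + _); rewrite addrCA.
Qed.
Definition copair_hom U V W (f : Hom U W) (g : Hom V W) : Hom (U * V)%type W :=
  mk_hom (copair_is_linear f g).

Definition inl_hom U V : Hom U (U * V)%type :=
  pair_hom (id_hom U) (hom_zero U V).
Definition inr_hom U V : Hom V (U * V)%type :=
  pair_hom (hom_zero V U) (id_hom V).

Lemma projective_zero U : zero_module U -> projective U.
Proof.
move=> U0 V W g f _; exists (hom_zero U V) => u /=.
by rewrite (U0 u) !linear0.
Qed.

Lemma injective_zero U : zero_module U -> injective_module U.
Proof.
by move=> U0 V W g f _; exists (hom_zero W U) => v; rewrite (U0 (f v)).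
Qed.

Lemma projective_prod P Q :
  projective P -> projective Q -> projective (P * Q)%type.
Proof.
move=> prP prQ U V g f gs.
have [h1 h1E] := prP U V g (comp_hom f (inl_hom P Q)) gs.
have [h2 h2E] := prQ U V g (comp_hom f (inr_hom P Q)) gs.
exists (copair_hom h1 h2) => -[p q] /=.
rewrite linearD; have /= -> := h1E p; have /= -> := h2E q.
by rewrite -linearD /=; congr (f (_, _)); rewrite ?addr0 ?add0r.
Qed.

Lemma injective_prod I J :
  injective_module I -> injective_module J -> injective_module (I * J)%type.
Proof.
move=> inI inJ U V g f gi.
have [h1 h1E] := inI U V g (comp_hom fst f) gi.
have [h2 h2E] := inJ U V g (comp_hom snd f) gi.
exists (pair_hom h1 h2) => u /=.
have /= -> := h1E u; have /= -> := h2E u; by case: (f u).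
Qed.

Definition proj_null X Y (f : Hom X Y) : bool :=
  `[< factors_through projective f >].
Definition inj_null X Y (f : Hom X Y) : bool :=
  `[< factors_through injective_module f >].

Lemma factors_through_zmod_closed C X Y :
  (forall U, zero_module U -> C U) ->
  (forall U V, C U -> C V -> C (U * V)%type) ->
  zmod_closed (fun f : Hom X Y => `[< factors_through C f >]).
Proof.
move=> C0 CD; split=> [|f g /asboolP[U CU [f1 [f2 fE]]] /asboolP[V CV [g1 [g2 gE]]]].
  apply/asboolP; exists 'rV[R]_0; first by apply: C0 => u; apply: thinmx0.
  by exists (hom_zero _ _), (hom_zero _ _).
apply/asboolP; exists (U * V)%type; first exact: CD.
exists (pair_hom f1 g1), (copair_hom f2 (hom_opp g2)) => x /=.
by have /= <- := fE x; have /= <- := gE x.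
Qed.

Fact proj_null_zmod_closed X Y : zmod_closed (@proj_null X Y).
Proof. exact: factors_through_zmod_closed projective_zero projective_prod. Qed.
HB.instance Definition _ X Y :=
  GRing.isZmodClosed.Build (Hom X Y) (@proj_null X Y) (proj_null_zmod_closed X Y).

Fact inj_null_zmod_closed X Y : zmod_closed (@inj_null X Y).
Proof. exact: factors_through_zmod_closed injective_zero injective_prod. Qed.
HB.instance Definition _ X Y :=
  GRing.isZmodClosed.Build (Hom X Y) (@inj_null X Y) (inj_null_zmod_closed X Y).

Definition proj_stable_hom X Y : zmodType := 
  Quotient.quot (GRing.ZmodClosed.clone (Hom X Y) (@proj_null X Y) _).
Definition inj_stable_hom X Y : zmodType := 
  Quotient.quot (GRing.ZmodClosed.clone (Hom X Y) (@inj_null X Y) _).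

End Stable.

Section Kernel.
Variables (R : nzRingType) (U V : lmodType R) (f : Hom U V).

Definition ker_pred : pred U := fun u => f u == 0.
Fact ker_submod_closed : submod_closed ker_pred.
Proof.
split=> [|a u v]; first by apply/eqP; rewrite linear0.
move=> /eqP fu /eqP fv; apply/eqP.
by rewrite linearP fu fv scaler0 addr0.
Qed.
HB.instance Definition _ := GRing.isSubmodClosed.Build R U ker_pred ker_submod_closed.

Record ker := Ker { ker_val : U; _ : ker_val \in ker_pred }.
HB.instance Definition _ := [isSub for ker_val].
HB.instance Definition _ := [Choice of ker by <:].
HB.instance Definition _ := [SubChoice_isSubLmodule of ker by <:].

Fact ker_val_is_linear : linear ker_val. Proof. by []. Qed.
Definition ker_incl : Hom ker U := mk_hom ker_val_is_linear.

Lemma ker_valP (x : ker) : f (ker_val x) = 0. Proof. by case: x => u /= /eqP. Qed.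

End Kernel.

Section FreeResolution.
Variable R : nzRingType.
Implicit Types X Y Z : lmodType R.

(* The free module on the underlying set of [X], and its augmentation onto [X]
   sending the basis vector <<x>> to [x]. *)
Definition free_mod X : lmodType R := {freeg X / R}.

Fact free_lift_is_linear X Y (f : X -> Y) : linear (fglift f : free_mod X -> Y).
Proof.
have fB : zmod_morphism (fglift f : free_mod X -> Y) := lift_is_additive f.
pose F : {additive free_mod X -> Y} :=
  HB.pack (fglift f : free_mod X -> Y) (GRing.isZmodMorphism.Build _ _ _ fB).
move=> a u v; rewrite -![fglift f _]/(F _) raddfD; congr (_ + _).
have FE : F u = \sum_(x <- dom u) coeff x u *: f x.
  by rewrite -[in LHS](freeg_sumE u) raddf_sum; apply: eq_bigr => x _; exact: liftU.
rewrite FE -[a *: u]/(fgscale a u) raddf_sum scaler_sumr.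
by apply: eq_bigr => x _; rewrite /= liftU scalerA.
Qed.
Definition free_lift X Y (f : X -> Y) : Hom (free_mod X) Y :=
  mk_hom (free_lift_is_linear f).

Lemma free_liftU X Y (f : X -> Y) (a : R) (x : X) :
  free_lift f << a *g x >> = a *: f x.
Proof. exact: liftU. Qed.

Lemma free_ext X Y (f g : Hom (free_mod X) Y) :
  (forall x, f << x >> = g << x >>) -> f = g.
Proof.
move=> fg; apply: homP => u; rewrite -[u]freeg_sumE !linear_sum.
apply: eq_bigr => x _; rewrite -[coeff x u]mulr1.
have -> : << coeff x u * 1 *g x >> = coeff x u *: << x >> :> free_mod X.
  by apply/eqP/freeg_eqP => y; rewrite coeffZ !coeffU mulrA.
by rewrite !linearZ fg.
Qed.

Definition free_aug X : Hom (free_mod X) X := free_lift id.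
Definition free_map X Y (u : Hom X Y) : Hom (free_mod X) (free_mod Y) :=
  free_lift (fun x => << u x >>).

Lemma free_aug_natural X Y (u : Hom X Y) (p : free_mod X) :
  free_aug Y (free_map u p) = u (free_aug X p).
Proof.
rewrite -[LHS]/(comp_hom (free_aug Y) (free_map u) p).
rewrite -[RHS]/(comp_hom u (free_aug X) p); congr (GRing.Linear.sort _ p).
apply: free_ext => x; rewrite -[LHS]/(free_aug Y (free_map u << x >>)).
rewrite -[RHS]/(u (free_aug X << x >>)).
by rewrite /free_map /free_aug !(free_liftU, scale1r).
Qed.

Definition omega X : lmodType R := ker (free_aug X).

Fact omega_map_subproof X Y (u : Hom X Y) (k : omega X) :
  free_map u (ker_val k) \in ker_pred (free_aug Y).
Proof. by apply/eqP; rewrite free_aug_natural ker_valP linear0. Qed.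

Fact omega_map_is_linear X Y (u : Hom X Y) :
  linear (fun k : omega X => Ker (omega_map_subproof u k) : omega Y).
Proof.
move=> a k l; apply: val_inj.
exact: (linearP (comp_hom (free_map u) (ker_incl (free_aug X)))).
Qed.
Definition omega_map X Y (u : Hom X Y) : Hom (omega X) (omega Y) :=
  mk_hom (omega_map_is_linear u).

Fixpoint syz n X : lmodType R := if n is m.+1 then omega (syz m X) else X.
Fixpoint syz_map n X Y (u : Hom X Y) : Hom (syz n X) (syz n Y) :=
  if n is m.+1 then omega_map (syz_map m u) else u.

(* The standard free resolution  ... -> res 1 X -> res 0 X -> X -> 0. *)
Definition res n X : lmodType R := free_mod (syz n X).
Definition res_d n X : Hom (res n.+1 X) (res n X) :=
  comp_hom (ker_incl (free_aug (syz n X))) (free_aug (syz n.+1 X)).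
Definition res_map n X Y (u : Hom X Y) : Hom (res n X) (res n Y) :=
  free_map (syz_map n u).

Lemma res_d_natural n X Y (u : Hom X Y) (p : res n.+1 X) :
  res_d n Y (res_map n.+1 u p) = res_map n u (res_d n X p).
Proof.
rewrite -[LHS]/(ker_val (free_aug (syz n.+1 Y) (free_map (syz_map n.+1 u) p))).
by rewrite free_aug_natural.
Qed.

(* The augmented complex [res] is indeed a projective resolution. *)
Lemma free_projective X : projective (free_mod X).
Proof.
move=> U V g f gs.
pose s x := projT1 (cid (gs (f << x >>))).
exists (free_lift s) => p.
rewrite -[LHS]/(comp_hom g (free_lift s) p); congr (GRing.Linear.sort _ p).
apply: free_ext => x; rewrite -[LHS]/(g (free_lift s << x >>)).
by rewrite free_liftU scale1r /s; case: cid.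
Qed.

Lemma free_aug_surj X (x : X) : exists p, free_aug X p = x.
Proof. by exists << x >>; rewrite /free_aug free_liftU scale1r. Qed.

Lemma res_exact0 X (p : res 0 X) :
  free_aug X p = 0 <-> exists q, res_d 0 X q = p.
Proof.
split=> [p0|[q <-]]; last exact: ker_valP.
have pk : p \in ker_pred (free_aug X) by apply/eqP.
have [q qE] := @free_aug_surj (omega X) (Ker pk); exists q.
exact: (congr1 (@ker_val _ _ _ _) qE).
Qed.

Lemma res_exact n X (p : res n.+1 X) :
  res_d n X p = 0 <-> exists q, res_d n.+1 X q = p.
Proof.
have valE : res_d n X p = 0 <-> free_aug (syz n.+1 X) p = 0.
  split=> [p0|p0]; first exact: val_inj.
  by rewrite -[LHS]/(ker_val (free_aug (syz n.+1 X) p)) p0.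
rewrite valE; split=> [p0|[q <-]]; last exact: ker_valP.
have pk : p \in ker_pred (free_aug (syz n.+1 X)) by apply/eqP.
have [q qE] := @free_aug_surj (omega (syz n.+1 X)) (Ker pk).
by exists q; exact: (congr1 (@ker_val _ _ _ _) qE).
Qed.

End FreeResolution.

Section Ext.
Variable R : nzRingType.
Implicit Types (X Y Z A B C : lmodType R) (n : nat).

Definition is_cocycle n X A (f : Hom (res n X) A) : bool :=
  comp_hom f (res_d n X) == 0.

Fact is_cocycle_zmod_closed n X A : zmod_closed (@is_cocycle n X A).
Proof.
split=> [|f g /eqP f0 /eqP g0]; apply/eqP; apply: homP => p //.
rewrite -[LHS]/(comp_hom f (res_d n X) p - comp_hom g (res_d n X) p).
by rewrite f0 g0 subrr.
Qed.
HB.instance Definition _ n X A := GRing.isZmodClosed.Build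
  (Hom (res n X) A) (@is_cocycle n X A) (is_cocycle_zmod_closed n X A).

Record cocycle n X A :=
  Cocycle { cocycle_val : Hom (res n X) A; _ : cocycle_val \in @is_cocycle n X A }.
HB.instance Definition _ n X A := [isSub for @cocycle_val n X A].
HB.instance Definition _ n X A := [Choice of cocycle n X A by <:].
HB.instance Definition _ n X A := [SubChoice_isSubZmodule of cocycle n X A by <:].

(* For [n = 0] the complex Hom (res _ X, A) has nothing in degree -1. *)
Definition coboundary n X A : Hom (res n X) A -> Prop :=
  match n with
  | 0 => fun f => f = 0
  | m.+1 => fun f => exists g : Hom (res m X) A, f = comp_hom g (res_d m X)
  end.
Definition is_coboundary n X A (f : cocycle n X A) : bool :=
  `[< coboundary (cocycle_val f) >].

Fact is_coboundary_zmod_closed n X A : zmod_closed (@is_coboundary n X A).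
Proof.
split=> [|f g /asboolP cf /asboolP cg]; apply/asboolP.
  case: n => [|n] //=; exists 0; exact: homP.
case: n f g cf cg => [|n] f g /=; first by move=> f0 g0; rewrite f0 g0 subrr.
by move=> [f' f'E] [g' g'E]; exists (f' - g'); rewrite f'E g'E; exact: homP.
Qed.
HB.instance Definition _ n X A := GRing.isZmodClosed.Build
  (cocycle n X A) (@is_coboundary n X A) (is_coboundary_zmod_closed n X A).

Definition Ext n X A : zmodType :=
  Quotient.quot (GRing.ZmodClosed.clone (cocycle n X A) (@is_coboundary n X A) _).

Fact cocycle_map_subproof n X Y A B (u : Hom Y X) (v : Hom A B)
    (f : cocycle n X A) :
  comp_hom v (comp_hom (cocycle_val f) (res_map n u)) \in @is_cocycle n Y B.
Proof.
case: f => f /= /eqP f0; apply/eqP; apply: homP => p.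
rewrite -[LHS]/(v (f (res_map n u (res_d n Y p)))) -res_d_natural.
rewrite -[f _]/(comp_hom f (res_d n X) (res_map n.+1 u p)) f0.
exact: linear0.
Qed.
Definition cocycle_map n X Y A B (u : Hom Y X) (v : Hom A B)
    (f : cocycle n X A) : cocycle n Y B :=
  Cocycle (cocycle_map_subproof u v f).

(* [Ext] as a bifunctor, contravariant in the first argument. *)
Definition Ext_map n X Y A B (u : Hom Y X) (v : Hom A B) (e : Ext n X A) :
    Ext n Y B :=
  \pi_(Ext n Y B) (cocycle_map u v (repr e)).

Lemma Ext_map_pi n X Y A B (u : Hom Y X) (v : Hom A B) (f : cocycle n X A) :
  Ext_map u v (\pi_(Ext n X A) f) = \pi_(Ext n Y B) (cocycle_map u v f).
Proof.
rewrite /Ext_map; case: piP => g /eqP.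
rewrite -Quotient.idealrBE => /asboolP fg.
apply/eqP; rewrite eq_sym -Quotient.idealrBE; apply/asboolP.
case: n f g fg => [|n] f g /=.
  move=> fg; apply: homP => p; rewrite /= -linearB.
  rewrite -[_ - _]/((cocycle_val f - cocycle_val g) (res_map 0 u p)).
  by rewrite fg linear0.
move=> [h hE]; exists (comp_hom v (comp_hom h (res_map n u))).
apply: homP => p; rewrite /= -linearB.
rewrite -[_ - _]/((cocycle_val f - cocycle_val g) (res_map n.+1 u p)).
rewrite hE -[LHS]/(v (h (res_d n X (res_map n.+1 u p)))).
by rewrite res_d_natural.
Qed.

Lemma Ext_map_is_zmod_morphism n X Y A B (u : Hom Y X) (v : Hom A B) :
  zmod_morphism (@Ext_map n X Y A B u v).
Proof.
move=> e e'; rewrite -[e]reprK -[e']reprK -raddfB !Ext_map_pi -raddfB.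
congr (\pi _); apply: val_inj; apply: homP => p.
exact: (linearB v).
Qed.
HB.instance Definition _ n X Y A B (u : Hom Y X) (v : Hom A B) :=
  GRing.isZmodMorphism.Build _ _ (@Ext_map n X Y A B u v)
    (Ext_map_is_zmod_morphism u v).

Lemma free_map_id X : free_map (id_hom X) = id_hom (free_mod X).
Proof. by apply: free_ext => x; rewrite /free_map free_liftU scale1r. Qed.

Lemma free_map_comp X Y Z (u : Hom X Y) (v : Hom Y Z) :
  free_map (comp_hom v u) = comp_hom (free_map v) (free_map u).
Proof.
apply: free_ext => x.
rewrite -[RHS]/(free_map v (free_map u << x >>)).
by rewrite /free_map !(free_liftU, scale1r).
Qed.

Lemma syz_map_id n X : syz_map n (id_hom X) = id_hom (syz n X).
Proof.
elim: n => //= n ->; apply: homP => k; apply: val_inj.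
by rewrite -[LHS]/(free_map (id_hom _) (ker_val k)) free_map_id.
Qed.

Lemma syz_map_comp n X Y Z (u : Hom X Y) (v : Hom Y Z) :
  syz_map n (comp_hom v u) = comp_hom (syz_map n v) (syz_map n u).
Proof.
elim: n => //= n ->; apply: homP => k; apply: val_inj.
by rewrite -[LHS]/(free_map (comp_hom _ _) (ker_val k)) free_map_comp.
Qed.

Lemma Ext_map_id n X A (e : Ext n X A) : Ext_map (id_hom X) (id_hom A) e = e.
Proof.
rewrite -[e]reprK Ext_map_pi; congr (\pi _); apply: val_inj.
apply: homP => p.
rewrite -[LHS]/(cocycle_val (repr e) (free_map (syz_map n (id_hom X)) p)).
by rewrite syz_map_id free_map_id.
Qed.

Lemma Ext_map_comp n X Y Z A B C (u : Hom Y X) (u' : Hom Z Y)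
    (v : Hom A B) (v' : Hom B C) (e : Ext n X A) :
  Ext_map (comp_hom u u') (comp_hom v' v) e = Ext_map u' v' (Ext_map u v e).
Proof.
rewrite -[e]reprK; move: (repr e) => f.
rewrite (Ext_map_pi u v) (Ext_map_pi u' v') (Ext_map_pi (comp_hom u u')).
congr (\pi _); apply: val_inj.
apply: homP => p.
rewrite -[LHS]/(v' (v (cocycle_val f
  (free_map (syz_map n (comp_hom u u')) p)))).
rewrite syz_map_comp free_map_comp; reflexivity.
Qed.

End Ext.

Section ClusterTilting.
Variables (R : nzRingType) (n : nat) (M : lmodType R -> Prop).
Implicit Types A B C : lmodType R.

Definition right_approx A B (f : Hom B A) : Prop :=
  M B /\ forall C (g : Hom C A), M C -> exists h : Hom C B, g =1 f \o h.

Definition left_approx A B (f : Hom A B) : Prop :=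
  M B /\ forall C (g : Hom A C), M C -> exists h : Hom B C, g =1 h \o f.

Definition functorially_finite : Prop :=
  forall A, fin_gen A ->
    (exists (B : lmodType R) (f : Hom B A), right_approx f) /\
    (exists (B : lmodType R) (f : Hom A B), left_approx f).

Definition generating : Prop :=
  forall A, fin_gen A ->
    exists (B : lmodType R) (f : Hom B A), M B /\ forall a, exists b, f b = a.

Definition cogenerating : Prop :=
  forall A, fin_gen A ->
    exists (B : lmodType R) (f : Hom A B), M B /\ injective f.

Definition Ext_vanish i A B : Prop := forall e : Ext i A B, e = 0.

Record additive_subcategory : Prop := AdditiveSubcategory {
  add_fin_gen : forall A, M A -> fin_gen A;
  add_zero : forall A, zero_module A -> M A;
  add_prod : forall A B, M A -> M B -> M (A * B)%type
}.

Record cluster_tilting : Prop := ClusterTilting {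
  ct_additive : additive_subcategory;
  ct_functorially_finite : functorially_finite;
  ct_generating : generating;
  ct_cogenerating : cogenerating;
  ct_right_orth : forall A, M A <->
    fin_gen A /\ (forall B i, M B -> (0 < i < n)%N -> Ext_vanish i B A);
  ct_left_orth : forall A, M A <->
    fin_gen A /\ (forall B i, M B -> (0 < i < n)%N -> Ext_vanish i A B)
}.

End ClusterTilting.

(* [Ext_cov_nat M n Y X] is the type of natural transformations from
   Ext^n(Y, -) to Ext^n(X, -), restricted to [M]; [Ext_con_nat M n X Y] is that
   of those from Ext^n(-, X) to Ext^n(-, Y).  They quantify over all modules,
   hence are too large to be MathComp [zmodType]s; their group law, computed
   pointwise, is given by [Ext_cov_add] and [Ext_con_add]. *)

Section NatExt.
Variables (R : nzRingType) (M : lmodType R -> Prop) (n : nat).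
Implicit Types A B X Y : lmodType R.

Record Ext_cov_nat Y X := ExtCovNat {
  cov_app : forall A, M A -> {additive Ext n Y A -> Ext n X A};
  cov_natural : forall A B (MA : M A) (MB : M B) (h : Hom A B) (e : Ext n Y A),
    cov_app MB (Ext_map (id_hom Y) h e) = Ext_map (id_hom X) h (cov_app MA e)
}.

Record Ext_con_nat X Y := ExtConNat {
  con_app : forall A, M A -> {additive Ext n A X -> Ext n A Y};
  con_natural : forall A B (MA : M A) (MB : M B) (h : Hom B A) (e : Ext n A X),
    con_app MB (Ext_map h (id_hom X) e) = Ext_map h (id_hom Y) (con_app MA e)
}.

Fact Ext_cov_add_natural Y X (s t : Ext_cov_nat Y X)
    A B (MA : M A) (MB : M B) (h : Hom A B) (e : Ext n Y A) :
  (cov_app s MB \+ cov_app t MB) (Ext_map (id_hom Y) h e) =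
  Ext_map (id_hom X) h ((cov_app s MA \+ cov_app t MA) e).
Proof. by rewrite /= raddfD !cov_natural. Qed.

Definition Ext_cov_add Y X (s t : Ext_cov_nat Y X) : Ext_cov_nat Y X :=
  @ExtCovNat Y X (fun A MA => cov_app s MA \+ cov_app t MA)
    (@Ext_cov_add_natural Y X s t).

Fact Ext_con_add_natural X Y (s t : Ext_con_nat X Y)
    A B (MA : M A) (MB : M B) (h : Hom B A) (e : Ext n A X) :
  (con_app s MB \+ con_app t MB) (Ext_map h (id_hom X) e) =
  Ext_map h (id_hom Y) ((con_app s MA \+ con_app t MA) e).
Proof. by rewrite /= raddfD !con_natural. Qed.

Definition Ext_con_add X Y (s t : Ext_con_nat X Y) : Ext_con_nat X Y :=
  @ExtConNat X Y (fun A MA => con_app s MA \+ con_app t MA)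
    (@Ext_con_add_natural X Y s t).

End NatExt.

(* Main.v *)
(** Splice exact sequences with middle terms in M to an exact sequence
    0 -> K -> N_{n-1} -> ... -> P -> Y -> 0, with P projective and all other
    kernels taken from right M-approximations, so that K lies in M.  It defines a
    class eta in Ext^n(Y, K).  The vanishing of Ext^i between objects of M
    (0 < i < n) shows, by dimension shifting, that every class in Ext^n(Y, A)
    with A in M is h_* eta for some h : K -> A; that u^* eta = 0 forces
    u : X -> Y to factor through P; and that every class in Ext^n(X, K) killed
    by the same maps K -> N as eta is u^* eta for some u.  So, as in Yoneda's
    lemma, a natural transformation is determined by its value on eta, which has
    the form u^* eta.  Part (ii) is dual, starting from X -> I with I injective
    and finitely generated.

    The standard resolution only gives easy access to the long exact sequence in
    the second variable, so statements about the first variable are obtained by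
    embedding A in a finitely generated injective module J and shifting along
    0 -> A -> J -> J/A -> 0.  Such a J is an essential extension of A of maximal
    length: filtering L by left ideals with simple quotients S_i bounds the
    k-length of every essential extension by the sum of the lengths of the
    Hom(S_i, A). *)

From HB Require Import structures.
From mathcomp Require Import all_boot all_algebra.
From mathcomp Require Import freeg boolp classical_sets.
Require Import Defs.

Set Implicit Arguments.
Unset Strict Implicit.
Unset Printing Implicit Defensive.

Import GRing.Theory.
Local Open Scope ring_scope.
Local Open Scope quotient_scope.

(** * Short exact sequences and Ext *)

Section ShortExact.
Variable R : nzRingType.
Implicit Types A B C X Y U V : lmodType R.

Lemma comp_homA A B C X (f : Hom C X) (g : Hom B C) (h : Hom A B) :
  comp_hom f (comp_hom g h) = comp_hom (comp_hom f g) h.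
Proof. exact: homP. Qed.

Lemma comp_homDr A B C (f : Hom B C) (g h : Hom A B) :
  comp_hom f (g + h) = comp_hom f g + comp_hom f h.
Proof. by apply: homP => x; exact: linearD. Qed.

Lemma hom_addE A B (f g : Hom A B) x : (f + g) x = f x + g x.
Proof. by []. Qed.
Lemma hom_oppE A B (f : Hom A B) x : (- f) x = - f x.
Proof. by []. Qed.
Lemma hom_subE A B (f g : Hom A B) x : (f - g) x = f x - g x.
Proof. by []. Qed.

Definition ses A B C (i : Hom A B) (p : Hom B C) : Prop :=
  [/\ injective i, forall c, exists b, p b = c & forall b, p b = 0 <-> exists a, i a = b].

Lemma ses_comp0 A B C (i : Hom A B) (p : Hom B C) : ses i p -> forall a, p (i a) = 0.
Proof. by case=> _ _ E a; apply/E; exists a. Qed.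

Lemma ses_lift A B C X (i : Hom A B) (p : Hom B C) (h : Hom X B) : ses i p ->
  (forall x, p (h x) = 0) -> exists g : Hom X A, forall x, i (g x) = h x.
Proof.
case=> injI _ E h0.
pose g x := projT1 (cid ((E (h x)).1 (h0 x))).
have gE x : i (g x) = h x by rewrite /g; case: cid.
have gl : linear g by move=> a u v; apply: injI; rewrite gE !linearP !gE.
by exists (mk_hom gl).
Qed.

Lemma factor_surj B C X (p : Hom B C) (h : Hom B X) : (forall c, exists b, p b = c) ->
  (forall b, p b = 0 -> h b = 0) -> exists g : Hom C X, forall b, g (p b) = h b.
Proof.
move=> surP h0.
pose s c := projT1 (cid (surP c)).
have sE c : p (s c) = c by rewrite /s; case: cid.
have hE b b' : p b = p b' -> h b = h b'.
  move=> bb; apply/eqP; rewrite -subr_eq0 -linearB; apply/eqP/h0.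
  by rewrite linearB bb subrr.
have gl : linear (fun c => h (s c)).
  by move=> a u v; rewrite -linearP; apply: hE; rewrite linearP !sE.
by exists (mk_hom gl) => b; apply: hE; rewrite sE.
Qed.

Lemma ses_factor A B C X (i : Hom A B) (p : Hom B C) (h : Hom B X) : ses i p ->
  (forall a, h (i a) = 0) -> exists g : Hom C X, forall b, g (p b) = h b.
Proof.
case=> _ surP E h0; apply: factor_surj => // b /E [a <-].
exact: h0.
Qed.

Lemma ses_ker B C (p : Hom B C) : (forall c, exists b, p b = c) -> ses (ker_incl p) p.
Proof.
move=> surP; split=> // [|b]; first exact: val_inj.
split=> [b0|[a <-]]; last exact: ker_valP.
by have bk : b \in ker_pred p; [apply/eqP | exists (Ker bk)].
Qed.

Lemma ses_omega X : ses (ker_incl (free_aug X)) (free_aug X).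
Proof. exact/ses_ker/free_aug_surj. Qed.

End ShortExact.

(** * Ext classes as maps out of syzygies; the long exact sequence in the second variable *)

Section ExtClass.
Variable R : nzRingType.
Implicit Types A B C X Y U V : lmodType R.
Implicit Types n : nat.

Notation incl Z := (ker_incl (free_aug Z)).

Fact cls_subproof n X A (f : Hom (syz n X) A) :
  comp_hom f (free_aug (syz n X)) \in @is_cocycle R n X A.
Proof.
apply/eqP; apply: homP => p.
rewrite -[LHS]/(f (free_aug (syz n X) (ker_val (free_aug (syz n.+1 X) p)))).
by rewrite ker_valP linear0.
Qed.

(** The standard resolution is exact, so the cocycles of degree [n] are the maps factoring through
    the [n]-th syzygy; maps out of the syzygy thus represent all classes. *)
Definition cls n X A (f : Hom (syz n X) A) : Ext n X A :=
  \pi_(Ext n X A) (Cocycle (cls_subproof f)).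

Lemma cls_surj n X A (e : Ext n X A) : exists f, cls f = e.
Proof.
rewrite -[e]reprK; move: (repr e) => [f fP].
have /eqP f0 := fP.
have [g gE] : exists g : Hom (syz n X) A, forall b, g (free_aug (syz n X) b) = f b.
  apply: (ses_factor (ses_omega _)) => a.
  have [q <-] := free_aug_surj a.
  by rewrite -[LHS]/(comp_hom f (res_d n X) q) f0.
exists g; congr (\pi _); apply: val_inj; apply: homP => x; exact: gE.
Qed.

Lemma clsD n X A (f g : Hom (syz n X) A) : cls (f + g) = cls f + cls g.
Proof.
rewrite /cls -raddfD; congr (\pi _); apply: val_inj; exact: homP.
Qed.

Definition ext_null n X A : Hom (syz n X) A -> Prop :=
  match n return Hom (syz n X) A -> Prop with
  | 0 => fun f => f = 0
  | m.+1 => fun f => exists g : Hom (free_mod (syz m X)) A, forall x, f x = g (incl _ x)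
  end.

Lemma cls_eq0 n X A (f : Hom (syz n X) A) : cls f = 0 <-> ext_null f.
Proof.
have -> : (cls f = 0) <-> coboundary (comp_hom f (free_aug (syz n X))).
  rewrite /cls -[0 : Ext n X A](raddf0 (\pi_(Ext n X A))).
  split=> [/eqP|cb]; last apply/eqP; rewrite -Quotient.idealrBE subr0.
    by move/asboolP.
  exact/asboolP.
case: n f => [|n] f /=; split.
- move=> f0; apply: homP => x; have [q <-] := free_aug_surj x.
  by rewrite -[LHS]/(comp_hom f (free_aug X) q) f0.
- by move=> ->; exact: homP.
- move=> [g gE]; exists g => x; have [q <-] := free_aug_surj x.
  by rewrite -[LHS]/(comp_hom f (free_aug (syz n.+1 X)) q) gE.
- by move=> [g gE]; exists g; apply: homP => x; rewrite /= gE.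
Qed.

Lemma cls_map n X Y A B (u : Hom Y X) (v : Hom A B) (f : Hom (syz n X) A) :
  Ext_map u v (cls f) = cls (comp_hom v (comp_hom f (syz_map n u))).
Proof.
rewrite Ext_map_pi; congr (\pi _); apply: val_inj; apply: homP => x.
by rewrite -[LHS]/(v (f (free_aug _ (free_map (syz_map n u) x)))) free_aug_natural.
Qed.

Local Notation post v := (Ext_map (id_hom _) v).
Local Notation pre u := (Ext_map u (id_hom _)).

Lemma cls_post n X A B (v : Hom A B) (f : Hom (syz n X) A) :
  post v (cls f) = cls (comp_hom v f).
Proof.
rewrite cls_map; congr cls; apply: homP => x.
by rewrite syz_map_id.
Qed.

Lemma cls_pre n X Y A (u : Hom Y X) (f : Hom (syz n X) A) :
  pre u (cls f) = cls (comp_hom f (syz_map n u)).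
Proof. by rewrite cls_map; congr cls; exact: homP. Qed.

Lemma pre_comp n X Y Z A (u : Hom Y X) (v : Hom Z Y) (e : Ext n X A) :
  pre (comp_hom u v) e = pre v (pre u e).
Proof.
rewrite -[RHS]Ext_map_comp; congr (Ext_map _ _ e); exact: homP.
Qed.

Lemma post_comp n X A B C (u : Hom A B) (v : Hom B C) (e : Ext n X A) :
  post (comp_hom v u) e = post v (post u e).
Proof.
rewrite -[RHS]Ext_map_comp; congr (Ext_map _ _ e); exact: homP.
Qed.

Lemma pre_post n X Y A B (u : Hom Y X) (v : Hom A B) (e : Ext n X A) :
  pre u (post v e) = post v (pre u e).
Proof.
rewrite -!Ext_map_comp; congr (Ext_map _ _ e); exact: homP.
Qed.

Lemma postD n X A B (v w : Hom A B) (e : Ext n X A) :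
  post (v + w) e = post v e + post w e.
Proof.
have [f <-] := cls_surj e; rewrite !cls_post -clsD; congr cls; exact: homP.
Qed.

Section Connecting.
Variables (A B C : lmodType R) (i : Hom A B) (p : Hom B C).
Hypothesis S : ses i p.

(* The connecting homomorphism sends the class of [g] to the class of [b]. *)
Definition conn n X (g : Hom (syz n X) C) (b : Hom (syz n.+1 X) A) : Prop :=
  exists t : Hom (free_mod (syz n X)) B,
    (forall x, p (t x) = g (free_aug _ x)) /\ (forall x, i (b x) = t (incl _ x)).

Lemma conn_exists n X (g : Hom (syz n X) C) : exists b, conn g b.
Proof.
have [_ surP _] := S.
have [t tE] := free_projective (comp_hom g (free_aug (syz n X))) surP.
have [b bE] : exists b : Hom (syz n.+1 X) A, forall x, i (b x) = comp_hom t (incl _) x.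
  apply: (ses_lift S) => x; have := tE (incl _ x); rewrite /= => ->.
  by have /= -> := ker_valP x; rewrite linear0.
by exists b, t; split.
Qed.

Lemma connD n X (g g' : Hom (syz n X) C) b b' :
  conn g b -> conn g' b' -> conn (g + g') (b + b').
Proof.
move=> [t [tg tb]] [t' [tg' tb']]; exists (t + t'); split=> x.
  by rewrite hom_addE linearD tg tg'.
by rewrite hom_addE linearD tb tb'.
Qed.

Lemma connN n X (g : Hom (syz n X) C) b : conn g b -> conn (- g) (- b).
Proof.
move=> [t [tg tb]]; exists (- t); split=> x.
  by rewrite hom_oppE linearN tg.
by rewrite hom_oppE linearN tb.
Qed.

(** An extension [h] of [g] to a free module lifts to [h'] with values in [B]. Subtracting its
    composite from [t] changes nothing on the syzygy and makes [t] land in the kernel of [p], which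
    yields the extension of [b]. In degree 0, [g = 0] and [t] itself works. *)
Lemma conn_null n X (g : Hom (syz n X) C) b : conn g b -> ext_null g -> ext_null b.
Proof.
move=> [t [tg tb]] g0; have [injI surP E] := S.
suff [t' t'p t'b] : exists2 t' : Hom (free_mod (syz n X)) B,
    (forall x, p (t' x) = 0) & forall x, t' (incl _ x) = t (incl _ x).
  have [s sE] := ses_lift S t'p.
  by exists s => x; apply: injI; rewrite tb sE t'b.
case: n g b t tg tb g0 => [|n] g b t tg tb /= g0.
  by exists t => // x; rewrite tg g0.
have [h hE] := g0; have [h' h'E] := free_projective h surP.
exists (t - comp_hom h' (comp_hom (incl _) (free_aug _))) => x; rewrite hom_subE.
  rewrite linearB tg hE /=.
  by have /= -> := h'E (ker_val (free_aug (omega (syz n X)) x)); rewrite subrr.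
have -> : comp_hom h' (comp_hom (incl _) (free_aug _)) (incl _ x) = 0.
  by rewrite -[LHS]/(h' (incl _ (free_aug _ (ker_val x)))) ker_valP !linear0.
by rewrite subr0.
Qed.

Lemma delta_subproof n X (e : Ext n X C) :
  exists e' : Ext n.+1 X A, exists g b, [/\ conn g b, cls g = e & cls b = e'].
Proof.
have [g <-] := cls_surj e; have [b gb] := conn_exists g.
by exists (cls b), g, b.
Qed.

Definition delta n X (e : Ext n X C) : Ext n.+1 X A := projT1 (cid (delta_subproof e)).

(** Independence of choices: the difference of two pairs related by [conn] is such a pair with null
    first component, so [conn_null] applies. *)
Lemma deltaE n X (g : Hom (syz n X) C) b : conn g b -> delta (cls g) = cls b.
Proof.
move=> gb; rewrite /delta; case: cid => _ /= [g' [b' [gb' gg' <-]]].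
have := conn_null (connD gb' (connN gb)); rewrite -!cls_eq0 !clsD gg' -clsD subrr.
have -> : cls (0 : Hom (syz n X) C) = 0 by apply/cls_eq0; case: (n) => // m; exists 0.
move=> /(_ erefl) /(congr1 (fun z => z + cls b)); rewrite add0r -addrA -clsD addNr.
by have -> : cls (0 : Hom (syz n.+1 X) A) = 0; [apply/cls_eq0; exists 0 | rewrite addr0].
Qed.

Lemma deltaD n X (e e' : Ext n X C) : delta (e + e') = delta e + delta e'.
Proof.
have [g <-] := cls_surj e; have [g' <-] := cls_surj e'.
have [b gb] := conn_exists g; have [b' gb'] := conn_exists g'.
by rewrite -clsD (deltaE (connD gb gb')) (deltaE gb) (deltaE gb') clsD.
Qed.

Lemma delta0 n X : delta (0 : Ext n X C) = 0.
Proof. by apply: (addrI (delta 0)); rewrite -deltaD !addr0. Qed.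

Lemma delta_pre n X Y (u : Hom Y X) (e : Ext n X C) : pre u (delta e) = delta (pre u e).
Proof.
have [g <-] := cls_surj e; have [b gb] := conn_exists g.
rewrite (deltaE gb) !cls_pre; apply/esym/deltaE; case: gb => t [tg tb].
exists (comp_hom t (free_map (syz_map n u))); split=> x /=; last by rewrite tb.
by rewrite tg free_aug_natural.
Qed.

(** This lemma and the next three give exactness at Ext^n(X, C) and Ext^(n+1)(X, A). Here an
    extension [s] of [b] makes [t - i s] vanish on the syzygy, so that it descends to a lift of
    [g]. *)
Lemma delta_eq0 n X (e : Ext n X C) : delta e = 0 -> exists e0 : Ext n X B, post p e0 = e.
Proof.
have [g <-] := cls_surj e; have [b gb] := conn_exists g.
rewrite (deltaE gb) => /cls_eq0 [s sE]; case: gb => t [tg tb].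
have [h hE] : exists h : Hom (syz n X) B, forall x, h (free_aug _ x) = (t - comp_hom i s) x.
  apply: (ses_factor (ses_omega _)) => a.
  by rewrite hom_subE /= -sE tb subrr.
exists (cls h); rewrite cls_post; congr cls; apply: homP => x.
have [q <-] := free_aug_surj x; rewrite /= hE hom_subE linearB tg /=.
by rewrite (ses_comp0 S) subr0.
Qed.

Lemma delta_post n X (e : Ext n X B) : delta (post p e) = 0.
Proof.
have [g <-] := cls_surj e; rewrite cls_post.
have gb : conn (comp_hom p g) 0.
  exists (comp_hom g (free_aug _)); split=> x //.
  by rewrite -[RHS]/(g (free_aug _ (ker_val x))) ker_valP !linear0.
by rewrite (deltaE gb); apply/cls_eq0; exists 0.
Qed.

Lemma post_eq0 n X (e : Ext n.+1 X A) : post i e = 0 -> exists e0 : Ext n X C, delta e0 = e.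
Proof.
have [b <-] := cls_surj e; rewrite cls_post => /cls_eq0 [t tE].
have [g gE] : exists g : Hom (syz n X) C, forall x, g (free_aug _ x) = comp_hom p t x.
  apply: (ses_factor (ses_omega _)) => a.
  by rewrite -[LHS]/(p (t (incl _ a))) -tE; exact: (ses_comp0 S).
by exists (cls g); apply: deltaE; exists t; split.
Qed.

Lemma post_delta n X (e : Ext n X C) : post i (delta e) = 0.
Proof.
have [g <-] := cls_surj e; have [b gb] := conn_exists g.
rewrite (deltaE gb) cls_post; apply/cls_eq0; case: gb => t [tg tb].
by exists t => x; rewrite -tb.
Qed.

End Connecting.

Lemma delta_morph A B C A' B' C' (i : Hom A B) (p : Hom B C) (i' : Hom A' B') (p' : Hom B' C')
    (S : ses i p) (S' : ses i' p') (a : Hom A A') (b : Hom B B') (c : Hom C C') :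
  (forall x, i' (a x) = b (i x)) -> (forall x, p' (b x) = c (p x)) ->
  forall n X (e : Ext n X C), delta S' (post c e) = post a (delta S e).
Proof.
move=> ab bc n X e; have [g <-] := cls_surj e; have [h gh] := conn_exists S g.
rewrite (deltaE S gh) !cls_post; apply: deltaE; case: gh => t [tg th].
by exists (comp_hom b t); split=> x /=; rewrite ?bc ?tg // ab th.
Qed.

End ExtClass.

(** * Submodules, quotients and length *)

Lemma dependent_choice (T : Type) (F : T -> Prop) (r : T -> T -> Prop) (x0 : T) :
  F x0 -> (forall x, F x -> exists2 y, F y & r x y) ->
  exists2 s : nat -> T, forall n, F (s n) & forall n, r (s n) (s n.+1).
Proof.
move=> F0 step.
have stepT (x : {x | F x}) : {y : {x | F x} | r (projT1 x) (projT1 y)}.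
  case: x => x Fx; have /cid2 [y Fy rxy] := step x Fx.
  by exists (exist _ y Fy).
pose s := fix s n := if n is m.+1 then projT1 (stepT (s m)) else exist _ x0 F0.
exists (fun n => projT1 (s n)) => n; first by case: (s n).
exact: projT2 (stepT (s n)).
Qed.

Section Submodules.
Variable R : nzRingType.
Implicit Types U V : lmodType R.

Record submod U := Submod {
  smem :> U -> Prop;
  smem0 : smem 0;
  smemP : forall a u v, smem u -> smem v -> smem (a *: u + v)
}.

Definition sle U (P Q : submod U) : Prop := forall u, P u -> Q u.

Lemma smemD U (P : submod U) u v : P u -> P v -> P (u + v).
Proof. by move=> Pu Pv; rewrite -[u]scale1r; exact: smemP. Qed.
Lemma smemZ U (P : submod U) a u : P u -> P (a *: u).
Proof. by move=> Pu; rewrite -[_ *: _]addr0; apply: smemP => //; exact: smem0. Qed.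
Lemma smemN U (P : submod U) u : P u -> P (- u).
Proof. by rewrite -scaleN1r; exact: smemZ. Qed.
Lemma smemB U (P : submod U) u v : P u -> P v -> P (u - v).
Proof. by move=> Pu Pv; exact/smemD/smemN. Qed.

Definition sm_full U : submod U := @Submod U (fun _ => True) I (fun _ _ _ _ _ => I).

Fact sm_zeroP U a (u v : U) : u = 0 -> v = 0 -> a *: u + v = 0.
Proof. by move=> -> ->; rewrite scaler0 addr0. Qed.
Definition sm_zero U : submod U := @Submod U (fun u => u = 0) erefl (@sm_zeroP U).

Fact sm_meetP U (P Q : submod U) a u v : P u /\ Q u -> P v /\ Q v ->
  P (a *: u + v) /\ Q (a *: u + v).
Proof. by move=> [? ?] [? ?]; split; exact: smemP. Qed.
Definition sm_meet U (P Q : submod U) : submod U :=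
  @Submod U (fun u => P u /\ Q u) (conj (smem0 P) (smem0 Q)) (@sm_meetP U P Q).

Fact sm_pre0 U V (f : Hom U V) (P : submod V) : P (f 0).
Proof. by rewrite linear0; exact: smem0. Qed.
Fact sm_preP U V (f : Hom U V) (P : submod V) a u v :
  P (f u) -> P (f v) -> P (f (a *: u + v)).
Proof. by move=> ? ?; rewrite linearP; exact: smemP. Qed.
Definition sm_pre U V (f : Hom U V) (P : submod V) : submod U :=
  @Submod U (fun u => P (f u)) (sm_pre0 f P) (@sm_preP U V f P).

Definition im_mem U V (f : Hom U V) (P : submod U) (v : V) := exists2 u, P u & f u = v.
Fact sm_im0 U V (f : Hom U V) (P : submod U) : im_mem f P 0.
Proof. by exists 0; [exact: smem0 | exact: linear0]. Qed.
Fact sm_imP U V (f : Hom U V) (P : submod U) a u v :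
  im_mem f P u -> im_mem f P v -> im_mem f P (a *: u + v).
Proof.
move=> [u' Pu <-] [v' Pv <-]; exists (a *: u' + v'); last exact: linearP.
exact: smemP.
Qed.
Definition sm_im U V (f : Hom U V) (P : submod U) : submod V :=
  @Submod V (im_mem f P) (sm_im0 f P) (@sm_imP U V f P).

Definition sum_mem U (P Q : submod U) (u : U) := exists p q, [/\ P p, Q q & u = p + q].
Fact sm_sum0 U (P Q : submod U) : sum_mem P Q 0.
Proof. by exists 0, 0; split; rewrite ?addr0 //; exact: smem0. Qed.
Fact sm_sumP U (P Q : submod U) a u v :
  sum_mem P Q u -> sum_mem P Q v -> sum_mem P Q (a *: u + v).
Proof.
move=> [p [q [Pp Qq ->]]] [p' [q' [Pp' Qq' ->]]].
exists (a *: p + p'), (a *: q + q'); split; [exact: smemP | exact: smemP|].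
by rewrite scalerDr addrACA.
Qed.
Definition sm_sum U (P Q : submod U) : submod U :=
  @Submod U (sum_mem P Q) (sm_sum0 P Q) (@sm_sumP U P Q).

Fact line_is_linear U (x : U) : linear (fun a : R^o => a *: x).
Proof. by move=> a u v; rewrite scalerDl scalerA. Qed.
Definition line_hom U (x : U) : Hom R^o U := mk_hom (line_is_linear x).
Definition sm_line U (x : U) : submod U := sm_im (line_hom x) (sm_full R^o).

Lemma sle_suml U (P Q : submod U) : sle P (sm_sum P Q).
Proof. by move=> u Pu; exists u, 0; split=> //; [exact: smem0 | rewrite addr0]. Qed.

Lemma sle_sumr U (P Q : submod U) : sle Q (sm_sum P Q).
Proof. by move=> u Qu; exists 0, u; split=> //; [exact: smem0 | rewrite add0r]. Qed.

Lemma mem_line U (x : U) : sm_line x x.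
Proof. by exists (1 : R^o); rewrite //= scale1r. Qed.

Definition disjoint_from U (T : U -> Prop) (P : submod U) := forall u, P u -> ~ T u.

Lemma max_disjoint U (T : U -> Prop) (G : submod U) : disjoint_from T G ->
  exists N, [/\ sle G N, disjoint_from T N &
    forall N', sle N N' -> disjoint_from T N' -> sle N' N].
Proof.
move=> GT.
(* [P] adjoins [G] to each set, because the empty chain has empty union, which must also satisfy
   [P]. *)
pose P (A : set U) := exists N : submod U,
  [/\ (forall u, N u <-> A u \/ G u), sle G N & disjoint_from T N].
have PU (F : set (set U)) : (F `<=` P)%classic -> total_on F subset ->
    P (\bigcup_(X in F) X)%classic.
  move=> FP totF; pose S u := (exists2 X, F X & X u) \/ G u.
  have S0 : S 0 by right; exact: smem0.
  have Sone X a u v : F X -> (X u \/ G u) -> (X v \/ G v) -> S (a *: u + v).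
    move=> FX; have [N [NE _ _]] := FP X FX.
    move=> /NE Nu /NE Nv; have /NE [] := smemP a Nu Nv; last by right.
    by left; exists X.
  have SP a u v : S u -> S v -> S (a *: u + v).
    case=> [[X FX Xu]|Gu] [[X' FX' Xv]|Gv].
    - have [XX'|X'X] := totF _ _ FX FX'.
        by apply: (Sone X') => //; left => //; exact: XX'.
      by apply: (Sone X) => //; left => //; exact: X'X.
    - by apply: (Sone X) => //; [left | right].
    - by apply: (Sone X') => //; [right | left].
    - by right; exact: smemP.
  exists (Submod S0 SP); split=> [u|u Gu|u].
  - by split=> -[]; [left | right | left | right].
  - by right.
  - case=> [[X FX Xu]|]; last exact: GT.
    by have [N [NE _ NT]] := FP X FX; apply: NT; apply/NE; left.
have [A [[N [NA GN NT]] maxA]] := Zorn_bigcup PU.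
exists N; split=> // N' NN' N'T u N'u; apply: contrapT => nNu.
apply: (maxA (fun u => N' u)); last first.
  exists N'; split=> // [v|v Gv]; last exact/NN'/GN.
  by split=> [|[//|Gv]]; [left | exact/NN'/GN].
split=> [v Av|N'A]; first by apply/NN'/NA; left.
by apply: nNu; apply/NA; left; exact: N'A.
Qed.

Section QuotientModule.
Variables (U : lmodType R) (P : submod U).

Definition smem_pred : {pred U} := fun u => `[< P u >].
Fact smem_submod_closed : submod_closed smem_pred.
Proof.
split=> [|a u v /asboolP Pu /asboolP Pv]; apply/asboolP; first exact: smem0.
exact: smemP.
Qed.
HB.instance Definition _ := GRing.isSubmodClosed.Build R U smem_pred smem_submod_closed.

Definition quo := Quotient.quot (GRing.ZmodClosed.clone U smem_pred _).
HB.instance Definition _ := GRing.Zmodule.on quo.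

Definition quo_pi (u : U) : quo := \pi_quo u.
Lemma quo_pi_eq u v : quo_pi u = quo_pi v <-> P (u - v).
Proof.
split=> [/eqP|Puv]; last apply/eqP; rewrite -Quotient.idealrBE; last exact/asboolP.
by move/asboolP.
Qed.
Lemma quo_piD u v : quo_pi (u + v) = quo_pi u + quo_pi v.
Proof. exact: raddfD. Qed.
Lemma quo_pi_surj x : exists u, quo_pi u = x.
Proof. by exists (repr x); exact: reprK. Qed.

Definition quo_scale (a : R) (x : quo) : quo := quo_pi (a *: repr x).
Lemma quo_scaleE a u : quo_scale a (quo_pi u) = quo_pi (a *: u).
Proof.
apply/quo_pi_eq; rewrite -scalerBr; apply/smemZ/quo_pi_eq.
exact: reprK.
Qed.

Fact quo_scalerA a b x : quo_scale a (quo_scale b x) = quo_scale (a * b) x.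
Proof. by have [u <-] := quo_pi_surj x; rewrite !quo_scaleE scalerA. Qed.
Fact quo_scale1r : left_id 1 quo_scale.
Proof. by move=> x; have [u <-] := quo_pi_surj x; rewrite quo_scaleE scale1r. Qed.
Fact quo_scalerDr : right_distributive quo_scale +%R.
Proof.
move=> a x y; have [u <-] := quo_pi_surj x; have [v <-] := quo_pi_surj y.
by rewrite -quo_piD !quo_scaleE scalerDr quo_piD.
Qed.
Fact quo_scalerDl x : {morph quo_scale^~ x : a b / a + b}.
Proof.
by move=> a b; have [u <-] := quo_pi_surj x; rewrite !quo_scaleE scalerDl quo_piD.
Qed.
HB.instance Definition _ :=
  GRing.Zmodule_isLmodule.Build R quo quo_scalerA quo_scale1r quo_scalerDr quo_scalerDl.

Fact quo_pi_linear : linear quo_pi.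
Proof. by move=> a u v; rewrite quo_piD -quo_scaleE. Qed.
Definition quo_hom : Hom U quo := mk_hom quo_pi_linear.

Lemma quo_hom_surj x : exists u, quo_hom u = x.
Proof. exact: quo_pi_surj. Qed.
Lemma quo_hom0 u : quo_hom u = 0 <-> P u.
Proof. by rewrite -(linear0 quo_hom) quo_pi_eq subr0. Qed.

End QuotientModule.

Lemma cokernel_exists U V (i : Hom U V) : injective i ->
  exists (W : lmodType R) (p : Hom V W), ses i p.
Proof.
move=> injI; exists (quo (sm_im i (sm_full U))), (quo_hom _); split=> //.
  exact: quo_hom_surj.
move=> b; rewrite quo_hom0; split=> [[u _ <-]|[u <-]]; first by exists u.
exact: (ex_intro2 _ _ u I).
Qed.

Section Length.
Variable U : lmodType R.
Implicit Types P Q : submod U.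

(* Counting strict inclusions along every ascending chain makes lengths additive by
   a comparison of chains, without Jordan-Hoelder. *)
Definition len_le P a : Prop := forall Q : nat -> submod U,
  (forall t, sle (Q t) (Q t.+1)) -> (forall t, sle (Q t) P) ->
  forall N, (\sum_(t < N) ~~ `[< sle (Q t.+1) (Q t) >] <= a)%N.
Definition fin_len P : Prop := exists a, len_le P a.

Lemma len_le_mono P P' a : sle P P' -> len_le P' a -> len_le P a.
Proof. by move=> PP' P'a Q Qi QP; apply: P'a => // t u /QP /PP'. Qed.

Lemma fin_len_mono P P' : sle P P' -> fin_len P' -> fin_len P.
Proof. by move=> PP' [a P'a]; exists a; exact: len_le_mono P'a. Qed.

End Length.

Lemma step_split (A B C : Prop) : (B -> C -> A) ->
  (~~ `[< A >] <= ~~ `[< B >] + ~~ `[< C >])%N.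
Proof.
move=> BCA; case: (asboolP A) => // nA; case: (asboolP B) => // b.
by case: (asboolP C) => // c; case: nA; exact: BCA.
Qed.

(** A chain in [P] is compared with its traces on [P'] and its images under [f]: where both are
    stationary, so is the chain. *)
Lemma len_le_hom U V (f : Hom U V) (P P' : submod U) (Q : submod V) a b :
  (forall u, P u -> f u = 0 -> P' u) -> (forall u, P u -> Q (f u)) ->
  len_le P' a -> len_le Q b -> len_le P (a + b).
Proof.
move=> kP imP P'a Qb C Ci CP N.
apply: (@leq_trans (\sum_(t < N) (~~ `[< sle (sm_meet P' (C t.+1)) (sm_meet P' (C t)) >]
                 + ~~ `[< sle (sm_im f (C t.+1)) (sm_im f (C t)) >]))%N).
  apply: leq_sum => t _; apply: step_split => meetE imE u Cu.
  have [|v Cv fv] := imE (f u); first by exists u.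
  have Cuv : C t.+1 (u - v) by apply: smemB => //; exact: Ci.
  have f0 : f (u - v) = 0 by rewrite linearB fv subrr.
  have [|_ Cuv'] := meetE (u - v); first by split=> //; apply: kP => //; exact: (CP t.+1).
  by rewrite -[u](subrK v); exact: smemD.
rewrite big_split; apply: leq_add.
  apply: (P'a (fun t => sm_meet P' (C t))) => [t u [? ?]|t u []] //; split=> //; exact: Ci.
apply: (Qb (fun t => sm_im f (C t))) => [t v [u Cu <-]|t v [u Cu <-]].
  by exists u => //; exact: Ci.
by apply: imP; exact: (CP t).
Qed.

Lemma fin_len_sum U (P P' : submod U) : fin_len P -> fin_len P' -> fin_len (sm_sum P P').
Proof.
move=> [a Pa] [b P'b]; exists (a + b) => C Ci CP N.
(* [D t] is the preimage in [P'] of the image of [C t] in (P + P')/P. *)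
pose D t := sm_meet P' (sm_sum (C t) P).
apply: (@leq_trans (\sum_(t < N) (~~ `[< sle (sm_meet P (C t.+1)) (sm_meet P (C t)) >]
                 + ~~ `[< sle (D t.+1) (D t) >]))%N).
  apply: leq_sum => t _; apply: step_split => meetE DE u Cu.
  have [p [q [Pp P'q uE]]] := CP t.+1 u Cu.
  have [|_ [v [r [Cv Pr qE]]]] := DE q.
    split=> //; exists u, (- p); split=> //; first exact: smemN.
    by rewrite uE addrC addKr.
  have [|_ Ct] := meetE (u - v).
    split; last by apply: smemB => //; exact: Ci.
    by rewrite uE qE addrCA addrC addrK; exact: smemD.
  by rewrite -[u](subrK v); exact: smemD.
rewrite big_split; apply: leq_add.
  apply: (Pa (fun t => sm_meet P (C t))) => [t u [? ?]|t u []] //; split=> //; exact: Ci.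
apply: (P'b D) => [t u [P'u [v [r [Cv Pr uE]]]]|t u []] //.
by split=> //; exists v, r; split=> //; exact: Ci.
Qed.

Lemma len_le_im U V (f : Hom U V) (P : submod U) (Q : submod V) a :
  (forall v, Q v -> exists2 u, P u & f u = v) -> len_le P a -> len_le Q a.
Proof.
move=> PQ Pa C Ci CQ N.
apply: leq_trans (Pa (fun t => sm_meet P (sm_pre f (C t))) _ _ N) => [|t u [Pu Cu]|t u []] //.
  apply: leq_sum => t _; case: asboolP => // nC.
  case: asboolP => // preE; case: nC => v Cv.
  have [u Pu fu] := PQ v (CQ _ _ Cv).
  by have [|_] := preE u; rewrite /= fu.
by split=> //; exact: Ci.
Qed.

Lemma fin_len_im U V (f : Hom U V) (P : submod U) (Q : submod V) :
  (forall v, Q v -> exists2 u, P u & f u = v) -> fin_len P -> fin_len Q.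
Proof. by move=> PQ [a Pa]; exists a; exact: (len_le_im PQ Pa). Qed.

Section Chains.
Variables (U : lmodType R) (P : submod U).
Hypothesis fP : fin_len P.

Lemma no_ascent (s : nat -> submod U) : (forall t, sle (s t) P) ->
  (forall t, sle (s t) (s t.+1)) -> (forall t, ~ sle (s t.+1) (s t)) -> False.
Proof.
have [a Pa] := fP; move=> sP si sn; have := Pa s si sP a.+1.
rewrite (eq_bigr (fun=> 1%N)) => [|t _]; last by rewrite asboolF //; exact: sn.
by rewrite sum_nat_const card_ord muln1 ltnn.
Qed.

Lemma no_descent (s : nat -> submod U) : (forall t, sle (s t) P) ->
  (forall t, sle (s t.+1) (s t)) -> (forall t, ~ sle (s t) (s t.+1)) -> False.
Proof.
have [a Pa] := fP; move=> sP si sn.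
(* The chain is read backwards from index [a.+1]. Truncated subtraction makes it constant
   afterwards, and the [a.+1] strict steps before already exceed the bound. *)
have si' t : sle (s (a.+1 - t)%N) (s (a.+1 - t.+1)%N).
  have [ta|ta] := leqP a.+1 t.
    by rewrite (eqP (ta : (_ - _ == 0)%N)) (eqP (leqW ta : (_ - _ == 0)%N)).
  by rewrite subSS subSn.
have := Pa (fun t => s (a.+1 - t)%N) si' (fun t => sP _) a.+1.
rewrite (eq_bigr (fun=> 1%N)) => [|t _].
  by rewrite sum_nat_const card_ord muln1 ltnn.
rewrite subSS subSn; last by rewrite -ltnS.
by rewrite asboolF //; exact: sn.
Qed.

Lemma max_exists (F : submod U -> Prop) : (forall Q, F Q -> sle Q P) -> (exists Q, F Q) ->
  exists2 Q, F Q & forall Q', F Q' -> sle Q Q' -> sle Q' Q.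
Proof.
move=> FP [Q0 FQ0]; apply: contrapT => nmax.
have [|s sF sr] := @dependent_choice _ F (fun Q Q' => sle Q Q' /\ ~ sle Q' Q) Q0 FQ0.
  move=> Q FQ; apply: contrapT => nQ; apply: nmax; exists Q => // Q' FQ' QQ'.
  by apply: contrapT => nQ'; apply: nQ; exists Q'.
by apply: (@no_ascent s) => t; [exact/FP | case: (sr t) | case: (sr t)].
Qed.

Lemma min_exists (F : submod U -> Prop) : (forall Q, F Q -> sle Q P) -> (exists Q, F Q) ->
  exists2 Q, F Q & forall Q', F Q' -> sle Q' Q -> sle Q Q'.
Proof.
move=> FP [Q0 FQ0]; apply: contrapT => nmin.
have [|s sF sr] := @dependent_choice _ F (fun Q Q' => sle Q' Q /\ ~ sle Q Q') Q0 FQ0.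
  move=> Q FQ; apply: contrapT => nQ; apply: nmin; exists Q => // Q' FQ' Q'Q.
  by apply: contrapT => nQ'; apply: nQ; exists Q'.
by apply: (@no_descent s) => t; [exact/FP | case: (sr t) | case: (sr t)].
Qed.

End Chains.
End Submodules.

Section FiniteSums.
Variable R : nzRingType.
Implicit Types U V : lmodType R.

Lemma len_le_zero U : len_le (sm_zero U) 0.
Proof.
move=> Q Qi Q0 N; rewrite big1 // => t _; rewrite asboolT //.
by move=> u /Q0 ->; exact: smem0.
Qed.

Lemma fin_len_zero U : fin_len (sm_zero U).
Proof. by exists 0%N; exact: len_le_zero. Qed.

Definition sm_sums U (I : Type) (r : seq I) (P : I -> submod U) : submod U :=
  \big[@sm_sum R U/sm_zero U]_(i <- r) P i.

Lemma sm_sums_mem U I (r : seq I) (P : I -> submod U) (x : I -> U) :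
  (forall i, P i (x i)) -> sm_sums r P (\sum_(i <- r) x i).
Proof.
move=> Px; rewrite /sm_sums; elim: r => [|i r IH]; rewrite ?big_nil // !big_cons.
by exists (x i), (\sum_(j <- r) x j).
Qed.

Lemma fin_len_sums U I (r : seq I) (P : I -> submod U) :
  (forall i, fin_len (P i)) -> fin_len (sm_sums r P).
Proof.
move=> fP; rewrite /sm_sums; elim: r => [|i r IH]; rewrite ?big_nil ?big_cons.
  exact: fin_len_zero.
exact: fin_len_sum.
Qed.

Lemma fin_len_gen A U m (f : 'I_m -> Hom A U) : fin_len (sm_full A) ->
  (forall u, exists a, u = \sum_i f i (a i)) -> fin_len (sm_full U).
Proof.
move=> fA genU.
apply: (@fin_len_mono _ _ _ (sm_sums (index_enum 'I_m) (fun i => sm_im (f i) (sm_full A)))).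
  move=> u _; have [a ->] := genU u; apply: sm_sums_mem => i.
  exact: (ex_intro2 _ _ (a i) I).
apply: fin_len_sums => i; apply: fin_len_im fA => v [u _ <-].
exact: (ex_intro2 _ _ u I).
Qed.

Lemma sm_lines_fin_gen U (s : seq U) u : sm_sums s (@sm_line R U) u ->
  exists c : nat -> R, u = \sum_(i < size s) c i *: s`_i.
Proof.
rewrite /sm_sums; elim: s u => [|x s IH] u.
  by rewrite big_nil => ->; exists (fun=> 0); rewrite big_ord0.
rewrite big_cons => -[_ [q [[a _ <-] /IH [c ->] ->]]].
by exists (fun n => if n is m.+1 then c m else a); rewrite big_ord_recl.
Qed.

Definition noetherian U : Prop := forall F : submod U -> Prop, (exists Q, F Q) ->
  exists2 Q, F Q & forall Q', F Q' -> sle Q Q' -> sle Q' Q.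

Lemma noetherian_fin_gen U : noetherian U -> fin_gen U.
Proof.
move=> noeU.
have [|_ [s ->] smax] := noeU (fun Q => exists s, Q = sm_sums s (@sm_line R U)).
  by exists (sm_sums [::] (@sm_line R U)), [::].
exists (size s), (fun i => s`_i) => u.
have su : sm_sums s (@sm_line R U) u.
  apply: (smax (sm_sums (u :: s) (@sm_line R U))).
  - by exists (u :: s).
  - by rewrite {2}/sm_sums big_cons; exact: sle_sumr.
  - rewrite /sm_sums big_cons; apply: sle_suml; exact: mem_line.
have [c cE] := sm_lines_fin_gen su.
by exists (fun i => c i).
Qed.

Lemma noetherian_inj U V (f : Hom U V) : injective f -> noetherian V -> noetherian U.
Proof.
move=> injf noeV F [Q0 FQ0].
have [|_ [Q FQ ->] Qmax] := noeV (fun P => exists2 Q, F Q & P = sm_im f Q).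
  by exists (sm_im f Q0), Q0.
exists Q => // Q' FQ' QQ' u Q'u.
have [|||v Qv /injf <- //] := Qmax (sm_im f Q') _ _ (f u).
- by exists Q'.
- by move=> _ [v /QQ' Qv <-]; exists v.
- by exists u.
Qed.

Lemma simple_len_le U (P : submod U) :
  (forall Q : submod U, sle Q P -> (forall u, Q u -> u = 0) \/ sle P Q) -> len_le P 1.
Proof.
move=> simP C Ci CP N.
(* For the induction the bound is sharpened to an indicator: the only possible strict step is the
   one that reaches [P]. *)
apply: (@leq_trans `[< sle P (C N) >]); last by case: asboolP.
elim: N => [|N IH]; first by rewrite big_ord0.
rewrite big_ord_recr /=; case: (asboolP (sle P (C N))) IH => [PN|nPN].
  rewrite (asboolT (_ : sle (C N.+1) (C N))); last by move=> u /CP /PN.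
  by rewrite addn0 (asboolT (_ : sle P (C N.+1))) // => u /PN /Ci.
rewrite leqn0 => /eqP ->; rewrite add0n.
have [C0|PC] := simP _ (CP N.+1); last first.
  by rewrite (asboolT PC); case: asboolP.
by rewrite (asboolT (_ : sle (C N.+1) (C N))) // => u /C0 ->; exact: smem0.
Qed.

End FiniteSums.

(** * Artinian commutative rings have finite length *)

Section ArtinianRing.
Variable k : comNzRingType.
Hypothesis art : artinian k.
Notation ideal := (submod k^o).

Lemma artinian_chain (s : nat -> ideal) : (forall t, sle (s t.+1) (s t)) ->
  exists t, sle (s t) (s t.+1).
Proof.
move=> si; have [||N NE] := art (I := fun t => smem_pred (s t)).
- by move=> t; exact: smem_submod_closed.
- by move=> t u /asboolP /si su; exact/asboolP.
exists N => u Nu; have := NE N.+1 (leqnSn N) u.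
have Nu' : u \in smem_pred (s N) by apply/asboolP.
by rewrite Nu' => /asboolP.
Qed.

Lemma artinian_min (F : ideal -> Prop) : (exists Q, F Q) ->
  exists2 Q, F Q & forall Q', F Q' -> sle Q' Q -> sle Q Q'.
Proof.
move=> [Q0 FQ0]; apply: contrapT => nmin.
have [|s sF sr] := @dependent_choice _ F (fun Q Q' => sle Q' Q /\ ~ sle Q Q') Q0 FQ0.
  move=> Q FQ; apply: contrapT => nQ; apply: nmin; exists Q => // Q' FQ' Q'Q.
  by apply: contrapT => nQ'; apply: nQ; exists Q'.
have [t] := artinian_chain (fun t => (sr t).1).
exact: (sr t).2.
Qed.

Fact mul_is_linear (a : k) : linear (fun x : k^o => a * x : k^o).
Proof. by move=> c u v; rewrite mulrDr mulrCA. Qed.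
Definition mul_hom (a : k) : Hom k^o k^o := mk_hom (mul_is_linear a).

(* A minimal ideal [I] of infinite length is a vector space over the field
   k / ann I: every element of [k] acts on [I] as zero or invertibly.  A maximal
   ideal avoiding a nonzero [x] in [I] therefore cuts out a complement of the line
   through [x], and that complement has finite length by minimality. *)
Lemma artinian_fin_len : fin_len (sm_full k^o).
Proof.
apply: contrapT => nfk.
have [I nfI Imin] := artinian_min (ex_intro (fun I => ~ fin_len I) _ nfk).
have fsub Q : sle Q I -> ~ sle I Q -> fin_len Q.
  by move=> QI nIQ; apply: contrapT => nfQ; apply: nIQ; exact: Imin.
(* Otherwise the kernel and the image of [a] on [I] are proper, hence of finite length by
   minimality, and so is [I]. *)
have dich a : sle I (sm_im (mul_hom a) I) \/ forall x, I x -> a * x = 0.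
  apply: contrapT => /not_orP [nim nker].
  have [c cP] : fin_len (sm_meet I (sm_pre (mul_hom a) (sm_zero _))).
    by apply: fsub => [u []|IK] //; apply: nker => x /IK [].
  have [d dP] : fin_len (sm_im (mul_hom a) I).
    by apply: fsub => // _ [x Ix <-]; exact: smemZ.
  apply: nfI; exists (c + d); apply: (len_le_hom (f := mul_hom a) _ _ cP dP) => u Iu //.
  by exists u.
have inv a : sle I (sm_im (mul_hom a) I) -> exists b, forall x, I x -> b * (a * x) = x.
  move=> aI.
  (* The ideals generated by the powers of [a] stabilise, so a^N = b a^(N+1). As [a] maps [I] onto
     itself, each element of [I] has the form a^N y, and [b] inverts [a] on it. *)
  have [|N sN] := @artinian_chain (fun n => sm_line (a ^+ n : k^o)).
    by move=> n _ [c _ <-]; exists (c * a) => //=; rewrite exprS -scalerA.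
  have [b _ /= bE] := sN _ (mem_line _).
  have powI n x : I x -> exists2 y, I y & a ^+ n * y = x.
    elim: n x => [|n IH] x Ix; first by exists x => //; rewrite mul1r.
    have [y Iy <-] := aI x Ix; have [z Iz <-] := IH y Iy.
    by exists z => //; rewrite /= exprS mulrA.
  exists b => x Ix; have [y Iy <-] := powI N x Ix.
  by rewrite [a * _]mulrA -exprS mulrA; congr (_ * y); exact: bE.
have [x Ix x0] : exists2 x, I x & x <> 0.
  apply: contrapT => I0; apply: nfI; apply: fin_len_mono (fin_len_zero _) => x Ix.
  by apply: contrapT => x0; apply: I0; exists x.
have [|N [_ Nx Nmax]] := @max_disjoint _ _ (fun u => u = x) (sm_zero k^o).
  by move=> u /= -> /esym.
have fC : fin_len (sm_meet I N).
  by apply: fsub => [u []|IC] //; have [_ /Nx] := IC x Ix.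
have act a y : I y -> a * y <> 0 -> exists b, forall z, I z -> b * (a * z) = z.
  by move=> Iy ay; apply: inv; have [//|/(_ y Iy)] := dich a.
have fx : fin_len (sm_line x).
  exists 1%N; apply: simple_len_le => Q Qx.
  have [Q0|/existsNP [y /not_implyP [Qy y0]]] := pselect (forall u, Q u -> u = 0).
    by left.
  right=> _ [c _ <-]; have [a _ /= aE] := Qx y Qy.
  have [|b bE] := act a x Ix; first by rewrite -[a * x]/(a *: x) aE.
  rewrite /= -[x]bE // -[a * x]/(a *: x) aE.
  by apply: smemZ; exact: (smemZ b Qy).
apply: nfI; apply: fin_len_mono (fin_len_sum fC fx) => y Iy.
have [Ny|nNy] := pselect (N y).
  by exists y, 0; split; rewrite ?addr0 //; exact: smem0.
(* By maximality of [N], x = n + a y for some [n] in [N]. As [x] is not in [N], a y is nonzero, so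
   [a] has an inverse [b] on [I] and y = b x - b n. *)
have /existsNP [z /not_implyP [[n [_ [Nn [a _ <-] zE]]] /contrapT zx]] :
    ~ disjoint_from (fun u => u = x) (sm_sum N (sm_line y)).
  move=> /(Nmax _ (@sle_suml _ _ _ _)) /(_ y) Ny; apply/nNy/Ny/sle_sumr.
  exact: mem_line.
have ayE : a * y = x - n by rewrite -zx zE /= [n + _]addrC addrK.
have [|b bE] := act a y Iy.
  by move=> ay0; apply: (Nx n Nn); move: ayE; rewrite ay0 => /esym /eqP; rewrite subr_eq0 => /eqP.
have yE : y = b * x - b * n by rewrite -mulrBr -ayE bE.
exists (- (b * n)), (b * x); split; last by rewrite addrC.
- split; last by apply: smemN; exact: (smemZ b Nn).
  have -> : - (b * n) = y - b * x by rewrite yE addrC addKr.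
  by apply: smemB => //; exact: (smemZ b Ix).
- by exists b.
Qed.

End ArtinianRing.

(** * Finitely generated injective modules over an artin algebra *)

Section Restriction.
Variables (k : comNzRingType) (L : algType k).
Implicit Types U V X Z : lmodType L.

(** Lengths are measured over [k] because multiplication by an element of [L] is only [k]-linear. *)
Definition restr U : Type := U.
HB.instance Definition _ U := GRing.Zmodule.on (restr U).

Definition restr_scale U (a : k) (u : restr U) : restr U := a%:A *: (u : U).
Fact restr_scalerA U a b (u : restr U) :
  restr_scale a (restr_scale b u) = restr_scale (a * b) u.
Proof. by rewrite /restr_scale scalerA -scalerAl mul1r scalerA. Qed.
Fact restr_scale1r U : left_id 1 (@restr_scale U).
Proof. by move=> u; rewrite /restr_scale !scale1r. Qed.
Fact restr_scalerDr U : right_distributive (@restr_scale U) +%R.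
Proof. by move=> a u v; rewrite /restr_scale scalerDr. Qed.
Fact restr_scalerDl U (u : restr U) : {morph (@restr_scale U)^~ u : a b / a + b}.
Proof. by move=> a b; rewrite /restr_scale !scalerDl. Qed.
HB.instance Definition _ U := GRing.Zmodule_isLmodule.Build k (restr U)
  (@restr_scalerA U) (@restr_scale1r U) (@restr_scalerDr U) (@restr_scalerDl U).

Fact restr_smP U (P : submod U) (a : k) (u v : restr U) :
  P u -> P v -> P (a *: u + v).
Proof. exact: smemP. Qed.
Definition restr_sm U (P : submod U) : submod (restr U) :=
  @Submod _ (restr U) (fun u => P u) (smem0 P) (@restr_smP U P).

Fact act_is_linear U (u : U) : linear (fun l : L => l *: u : restr U).
Proof. by move=> a l l'; rewrite scalerDl -[a *: l]mulr_algl -scalerA. Qed.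
Definition act_hom U (u : U) : @Hom k L (restr U) := mk_hom (act_is_linear u).

Fact scale_is_linear U (l : L) : linear (fun u : restr U => l *: (u : U) : restr U).
Proof.
move=> a u v; rewrite scalerDr scalerA mulr_algr; congr (_ + _).
by rewrite -[a *: l]mulr_algl -scalerA.
Qed.
Definition scale_hom U (l : L) : @Hom k (restr U) (restr U) :=
  mk_hom (@scale_is_linear U l).

Fact restr_hom_is_linear U V (f : Hom U V) : linear (fun u : restr U => f u : restr V).
Proof. by move=> a u v; rewrite /= linearD linearZ. Qed.
Definition restr_hom U V (f : Hom U V) : @Hom k (restr U) (restr V) :=
  mk_hom (restr_hom_is_linear f).

Definition fin_len_k U := fin_len (sm_full (restr U)).

Lemma fin_len_max U (F : submod U -> Prop) : fin_len_k U -> (exists Q, F Q) ->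
  exists2 Q, F Q & forall Q', F Q' -> sle Q Q' -> sle Q' Q.
Proof.
move=> fU [Q0 FQ0].
have [//||_ [Q FQ ->] Qmax] := max_exists fU (F := fun P => exists2 Q, F Q & P = restr_sm Q).
  by exists (restr_sm Q0), Q0.
exists Q => // Q' FQ' QQ'; apply: (Qmax (restr_sm Q')) => //.
by exists Q'.
Qed.

Lemma fin_len_min U (F : submod U -> Prop) : fin_len_k U -> (exists Q, F Q) ->
  exists2 Q, F Q & forall Q', F Q' -> sle Q' Q -> sle Q Q'.
Proof.
move=> fU [Q0 FQ0].
have [//||_ [Q FQ ->] Qmin] := min_exists fU (F := fun P => exists2 Q, F Q & P = restr_sm Q).
  by exists (restr_sm Q0), Q0.
exists Q => // Q' FQ' QQ'; apply: (Qmin (restr_sm Q')) => //.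
by exists Q'.
Qed.

Lemma fin_len_k_noetherian U : fin_len_k U -> noetherian U.
Proof. by move=> fU F; exact: fin_len_max. Qed.

Lemma fin_len_k_fin_gen U : fin_len_k U -> fin_gen U.
Proof. by move=> /fin_len_k_noetherian /noetherian_fin_gen. Qed.

Section ArtinAlgebra.
Hypothesis HL : artin_algebra L.

Lemma fin_gen_fin_len U : fin_gen U -> fin_len_k U.
Proof.
have [art [m [g gE]]] := HL => -[p [h hE]].
have fL : fin_len (sm_full L).
  apply: (fin_len_gen (f := fun i => line_hom (g i))) (artinian_fin_len art) _ => l.
  by have [c ->] := gE l; exists c.
apply: (fin_len_gen (f := fun i => act_hom (h i))) fL _ => u.
by have [c ->] := hE u; exists c.
Qed.

Lemma fin_gen_inj U V (f : Hom U V) : injective f -> fin_gen V -> fin_gen U.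
Proof.
move=> injf /fin_gen_fin_len /fin_len_k_noetherian noeV.
exact/noetherian_fin_gen/(noetherian_inj injf).
Qed.

Definition essential U V (i : Hom U V) : Prop :=
  injective i /\ forall z, z <> 0 -> exists l x, l *: z = i x /\ l *: z <> 0.

Fact ann0 Z (H : submod (L^o : lmodType L)) : forall h, H h -> h *: (0 : Z) = 0.
Proof. by move=> h _; rewrite scaler0. Qed.
Fact annP Z (H : submod (L^o : lmodType L)) (a : k) (u v : restr Z) :
  (forall h, H h -> h *: (u : Z) = 0) -> (forall h, H h -> h *: (v : Z) = 0) ->
  forall h, H h -> h *: (a *: u + v : Z) = 0.
Proof.
move=> u0 v0 h Hh; rewrite -[LHS]/(scale_hom Z h (a *: u + v)) linearP /=.
by rewrite u0 // v0 // scaler0 addr0.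
Qed.
(** For a left ideal [H] this is Hom_L(L/H, Z), in general only a [k]-submodule of [Z]. *)
Definition ann Z (H : submod (L^o : lmodType L)) : submod (restr Z) :=
  @Submod _ (restr Z) (fun u => forall h, H h -> h *: (u : Z) = 0)
    (@ann0 Z H) (@annP Z H).

(* If [H / H'] is simple and generated by [x], then multiplication by [x] embeds
   [ann Z H'] modulo [ann Z H] into [X]: each [x *: z] is zero or generates a simple
   submodule of [Z], which then lies in the essential submodule [X]. *)
Lemma essential_bound X : fin_gen X -> exists b, forall Z (i : Hom X Z),
  essential i -> len_le (sm_full (restr Z)) b.
Proof.
move=> /fin_gen_fin_len [a aX].
have fL : fin_len_k (L^o : lmodType L).
  apply: fin_gen_fin_len; exists 1%N, (fun=> 1) => l; exists (fun=> l).
  by rewrite big_ord_recl big_ord0 addr0 /GRing.scale /= mulr1.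
pose good (H : submod (L^o : lmodType L)) :=
  exists b, forall Z (i : Hom X Z), essential i -> len_le (ann Z H) b.
(* A bound independent of [Z] exists for [H] equal to [L], with annihilator zero. A minimal such [H]
   is shown to be zero, and then the annihilator is all of [Z]. *)
have [|H [b Hb] Hmin] := fin_len_min (F := good) fL.
  exists (sm_full _), 0%N => Z i _; apply: (@len_le_mono _ _ _ (sm_zero (restr Z))) => [z zP|].
    by rewrite -[z](scale1r (z : Z)); exact: zP.
  exact: len_le_zero.
suff H0 : sle H (sm_zero _).
  exists b => Z i ei; apply: len_le_mono (Hb Z i ei) => z _ h /H0 ->.
  exact: scale0r.
apply: contrapT => nH0.
have [|H' [H'H nH'] H'max] := fin_len_max (F := fun Q => sle Q H /\ ~ sle H Q) fL.
  by exists (sm_zero _); split=> // u ->; exact: smem0.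
apply/nH'/(Hmin H') => //; exists (b + a)%N => Z i ei; have [injI essI] := ei.
have /existsNP [x /not_implyP [Hx nH'x]] := nH'.
have H'gen (y : L^o) : H y -> ~ H' y -> sle H (sm_sum H' (sm_line y)).
  move=> Hy nH'y; apply: contrapT => nHy; apply: nH'y.
  have := H'max (sm_sum H' (sm_line y)); apply.
  - split=> // _ [p [_ [/H'H Hp [l _ <-] ->]]].
    by apply: smemD => //; exact: (smemZ l Hy).
  - exact: sle_suml.
  - by apply: sle_sumr; exact: mem_line.
have iX : len_le (sm_im (restr_hom i) (sm_full _)) a.
  by apply: len_le_im aX => v [u ? <-]; exists u.
apply: (len_le_hom (f := scale_hom Z x)) (Hb Z i ei) iX => [z H'z xz0 h Hh|z H'z].
  have [p [_ [H'p [l _ <-] ->]]] := H'gen x Hx nH'x h Hh.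
  by rewrite scalerDl H'z // add0r -[X in X *: _]/(l * x) -scalerA xz0 scaler0.
have [xz0|xz0] := pselect (x *: (z : Z) = 0).
  by rewrite -[scale_hom _ _ _]/(x *: (z : Z)) xz0; exact: smem0.
have [l [y [ly ly0]]] := essI _ xz0.
have /(H'gen _ (smemZ l Hx)) /(_ x Hx) [p [_ [H'p [l' _ <-] xE]]] : ~ H' (l *: x).
  by move=> H'lx; apply: ly0; rewrite scalerA; exact: H'z H'lx.
exists (l' *: y) => //; rewrite -[LHS]/(i (l' *: y)) linearZ /= -ly.
transitivity ((p + l' * (l * x)) *: (z : Z)).
  by rewrite scalerDl (H'z p H'p) add0r -!scalerA.
exact: (congr1 (fun h : L => h *: (z : Z)) (esym xE)).
Qed.

(** [Z] carries a chain with the largest number of strict steps found in any essential extension,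
    finite by [essential_bound]. A proper essential extension [Z'] of it would add a last step, up
    to all of [Z']. *)
Lemma max_essential X : fin_gen X -> exists Z (i : Hom X Z), [/\ fin_gen Z, essential i &
  forall Z' (j : Hom Z Z'), injective j -> essential (comp_hom j i) ->
    forall z', exists z, j z = z'].
Proof.
move=> /essential_bound [b bP].
pose cnt c := exists Z (i : Hom X Z) (Q : nat -> submod (restr Z)) N,
  [/\ essential i, forall t, sle (Q t) (Q t.+1) &
      (\sum_(t < N) ~~ `[< sle (Q t.+1) (Q t) >] = c)%N].
have cnt_b c : cnt c -> (c <= b)%N.
  by move=> [Z [i [Q [N [ei Qi <-]]]]]; apply: (bP Z i ei Q Qi).
have [|c cb|c /asboolP [Z [i [Q [N [ei Qi Qc]]]]] cmax] := @ex_maxnP (fun c => `[< cnt c >]) b.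
- exists 0%N; apply/asboolP; exists X, (id_hom X), (fun=> sm_full _), 0%N.
  split=> //; last by rewrite big_ord0.
  by split=> // z z0; exists 1, z; rewrite scale1r.
- exact/cnt_b/asboolP.
exists Z, i; split=> //; first by apply: fin_len_k_fin_gen; exists b; exact: (bP Z i ei).
move=> Z' j injj eji; apply: contrapT => /existsNP [z' nz'].
pose Q' t := if (t <= N)%N then sm_im (restr_hom j) (Q t) else sm_full (restr Z').
suff : (c.+1 <= c)%N by rewrite ltnn.
apply/cmax/asboolP; exists Z', (comp_hom j i), Q', N.+1; split=> // [t|].
  rewrite /Q'; case: (ltnP t N) => [tN|_]; last by [].
  by rewrite ltnW // => _ [z Qz <-]; exists z => //; exact: Qi.
rewrite big_ord_recr /= -[RHS]addn1; congr (_ + _)%N.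
  rewrite -Qc; apply: eq_bigr => t _; congr (nat_of_bool (~~ _)).
  rewrite /Q' (ltn_ord t) ltnW //.
  apply/asboolP/asboolP => QQ z Qz; last by case: Qz => y /QQ Qy <-; exists y.
  by have [|y Qy /injj <-] := QQ (j z); first by exists z.
rewrite asboolF // /Q' leqnn ltnn => /(_ z' I) [z _ zz'].
by apply: nz'; exists z.
Qed.

(* The pushout of [f] and [g], divided by a maximal submodule meeting [Z]
   trivially, is an essential extension of [Z], hence equal to [Z]. *)
Theorem injective_embedding X : fin_gen X ->
  exists J (i : Hom X J), [/\ fin_gen J, injective_module J & injective i].
Proof.
move=> /max_essential [Z [i [fZ [injI essI] Zmax]]].
exists Z, i; split=> // U V g f injg.
pose gf := pair_hom f (hom_opp g).
pose bad (w : Z * V) := w.2 = 0 /\ w.1 <> 0.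
have [|N [GN Nbad Nmax]] := @max_disjoint _ _ bad (sm_im gf (sm_full _)).
  move=> _ [u _ <-] [/= /eqP]; rewrite oppr_eq0 => /eqP gu0 fu; apply: fu.
  by have -> : u = 0; [apply: injg; rewrite gu0 linear0 | rewrite linear0].
pose j := comp_hom (quo_hom N) (inl_hom Z V).
have jE z : j z = quo_hom N (z, 0) by [].
have injj : injective j.
  move=> z z' zz'; apply/eqP; rewrite -subr_eq0; apply/eqP; apply: contrapT => nz.
  have /quo_hom0 : quo_hom N (z - z', 0) = 0 by rewrite -jE linearB zz' subrr.
  by move/Nbad; case.
have eji : essential (comp_hom j i).
  split=> [x y /injj /injI //|q q0].
  have [w wq] := quo_hom_surj q.
  have nNw : ~ N w by move=> /quo_hom0 w0; apply: q0; rewrite -wq.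
  (* Maximality of [N] puts a nonzero element of [Z] into the sum of [N] and the line of [w], and
     [i] is essential in [Z]. *)
  have /existsNP [v /not_implyP [[n [_ [Nn [l _ <-] vE]]] /contrapT [v20 v10]]] :
      ~ disjoint_from bad (sm_sum N (sm_line w)).
    move=> /(Nmax _ (@sle_suml _ _ _ _)) /(_ w) Nw; apply/nNw/Nw/sle_sumr.
    exact: mem_line.
  have lq : l *: q = j v.1.
    rewrite -wq -linearZ jE -v20 -surjective_pairing vE linearD.
    by rewrite (quo_hom0 N n).2 // add0r.
  have [l' [x [lx lx0]]] := essI _ v10.
  exists (l' * l), x; rewrite -scalerA lq -linearZ lx; split=> // jix.
  by apply: lx0; rewrite lx; apply: injj; rewrite linear0.
have surj := Zmax _ j injj eji.
have sj : ses j (hom_zero _ 'rV[L]_0).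
  by split=> // c; exists 0; rewrite [c]thinmx0.
have [h hE] := ses_lift (h := comp_hom (quo_hom N) (inr_hom Z V)) sj (fun=> erefl).
exists h => u; apply: injj; rewrite hE jE /=; apply/quo_pi_eq.
have := smemN (GN (gf u) (ex_intro2 _ _ u I erefl)).
by congr (N _); congr (_, _); rewrite /= ?subr0 ?sub0r ?opprK ?add0r.
Qed.

End ArtinAlgebra.
End Restriction.

(** * Dimension shifting in the second variable *)

Local Notation post v := (Ext_map (id_hom _) v).
Local Notation pre u := (Ext_map u (id_hom _)).

Section DimensionShift.
Variable R : nzRingType.
Implicit Types A B C X Y N J : lmodType R.

Lemma fin_gen_surj A B (p : Hom A B) : (forall b, exists a, p a = b) -> fin_gen A -> fin_gen B.
Proof.
move=> surP [m [g gE]]; exists m, (fun i => p (g i)) => b.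
have [a <-] := surP b; have [c ->] := gE a; exists c.
by rewrite linear_sum; apply: eq_bigr => i _; rewrite linearZ.
Qed.

Lemma Ext_injective n X J : injective_module J -> Ext_vanish n.+1 X J.
Proof.
move=> injJ e; have [f <-] := cls_surj e; apply/cls_eq0.
have [g gE] := injJ _ _ (ker_incl (free_aug (syz n X))) f val_inj.
by exists g => x; rewrite -gE.
Qed.

Definition cls0 X A (f : Hom X A) : Ext 0 X A := @cls R 0 X A f.

Lemma cls0_inj X A (f g : Hom X A) : cls0 f = cls0 g -> f = g.
Proof.
move=> fg; apply/eqP; rewrite -subr_eq0; apply/eqP.
apply/(@cls_eq0 R 0 X A (f - g))/(addIr (cls0 g)).
by rewrite add0r -[RHS]fg /cls0 -clsD subrK.
Qed.

Lemma cls0_surj X A (e : Ext 0 X A) : exists f, cls0 f = e.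
Proof. exact: (@cls_surj R 0 X A e). Qed.

Lemma post_cls0 X A B (v : Hom A B) (f : Hom X A) : post v (cls0 f) = cls0 (comp_hom v f).
Proof. exact: (@cls_post R 0 X). Qed.

Lemma pre_cls0 X Y A (u : Hom Y X) (f : Hom X A) : pre u (cls0 f) = cls0 (comp_hom f u).
Proof. exact: (@cls_pre R 0 X). Qed.

Lemma comp_id_r X A (f : Hom X A) : comp_hom f (id_hom X) = f.
Proof. exact: homP. Qed.
Lemma comp_id_l X A (f : Hom X A) : comp_hom (id_hom A) f = f.
Proof. exact: homP. Qed.

Section OneSequence.
Variables (A B C : lmodType R) (i : Hom A B) (p : Hom B C) (S : ses i p).

Lemma delta_cls0_eq0 X (h : Hom X C) :
  delta S (cls0 h) = 0 -> exists g : Hom X B, comp_hom p g = h.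
Proof.
move=> /delta_eq0 [e]; have [g <-] := cls0_surj e.
by rewrite post_cls0 => /cls0_inj <-; exists g.
Qed.

Lemma vanish_lift X (h : Hom X C) : Ext_vanish 1 X A -> exists g : Hom X B, comp_hom p g = h.
Proof. by move=> /(_ (delta S (cls0 h))) /delta_cls0_eq0. Qed.

Lemma vanish_delta n X (e : Ext n.+1 X A) : Ext_vanish n.+1 X B -> exists e', delta S e' = e.
Proof. by move=> XB; exact/post_eq0/XB. Qed.

Lemma vanish_delta_inj n X (e : Ext n.+1 X C) : Ext_vanish n.+1 X B -> delta S e = 0 -> e = 0.
Proof. by move=> XB /delta_eq0 [e0 <-]; rewrite (XB e0) raddf0. Qed.

Hypothesis injB : injective_module B.

Lemma inj_delta n X (e : Ext n.+1 X A) : exists e', delta S e' = e.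
Proof. exact/vanish_delta/Ext_injective. Qed.

Lemma inj_delta_inj n X (e : Ext n.+1 X C) : delta S e = 0 -> e = 0.
Proof. exact/vanish_delta_inj/Ext_injective. Qed.

Lemma vanish_shift n X : Ext_vanish n.+2 X A -> Ext_vanish n.+1 X C.
Proof. by move=> XA e; apply: inj_delta_inj. Qed.

End OneSequence.
Arguments inj_delta_inj {A B C i p} S.

Lemma ses_map_left A B C A' B' C' (i : Hom A B) (p : Hom B C) (i' : Hom A' B') (p' : Hom B' C')
    (S : ses i p) (S' : ses i' p') (g : Hom B B') (c : Hom C C') :
  comp_hom p' g = comp_hom c p -> exists a : Hom A A',
  (forall x, i' (a x) = g (i x)) /\
  forall n X (e : Ext n X C), delta S' (post c e) = post a (delta S e).
Proof.
move=> pg; have pgE x : p' (g x) = c (p x) := congr1 (fun f : Hom _ _ => f x) pg.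
have [x|a aE] := ses_lift (h := comp_hom g i) S'.
  by rewrite /= pgE (ses_comp0 S) linear0.
exists a; split=> // n X e; exact: (delta_morph S S' aE pgE).
Qed.

Lemma ses_map_right A B C A' B' C' (i : Hom A B) (p : Hom B C) (i' : Hom A' B') (p' : Hom B' C')
    (S : ses i p) (S' : ses i' p') (a : Hom A A') (g : Hom B B') :
  comp_hom g i = comp_hom i' a -> exists c : Hom C C',
  (forall x, c (p x) = p' (g x)) /\
  forall n X (e : Ext n X C), delta S' (post c e) = post a (delta S e).
Proof.
move=> ga; have gaE x : g (i x) = i' (a x) := congr1 (fun f : Hom _ _ => f x) ga.
have [x|c cE] := ses_factor (h := comp_hom p' g) S.
  by rewrite /= gaE (ses_comp0 S').
by exists c; split=> // n X e; apply: (delta_morph S S' (b := g)) => x.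
Qed.

(** * Classes spliced from exact sequences with middle terms in [M] *)

Section Splicing.
Variable M : lmodType R -> Prop.

(* [spliced e0 e] : [e] is the Yoneda product of [e0] with an exact sequence
   whose middle terms lie in [M]. *)
Inductive spliced C n0 A0 (e0 : Ext n0 C A0) : forall n A, Ext n C A -> Prop :=
| spliced_base : spliced e0 e0
| spliced_step n A N A' (i : Hom A N) (p : Hom N A') (S : ses i p) (e : Ext n C A') :
    M N -> spliced e0 e -> spliced e0 (delta S e).

Lemma spliced_trans C n0 A0 (e0 : Ext n0 C A0) n1 A1 (e1 : Ext n1 C A1) n A (e : Ext n C A) :
  spliced e0 e1 -> spliced e1 e -> spliced e0 e.
Proof. by move=> s01; elim=> // *; exact: spliced_step. Qed.

(** In degree 0 only the base case occurs, so [K] is [C]. The map [t] carries this identification,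
    and the match on [n] spares an inversion on dependent indices. *)
Lemma spliced0_inv C n K (eta : Ext n C K) : spliced (cls0 (id_hom C)) eta ->
  match n return Ext n C K -> Prop with
  | 0 => fun e => exists2 t : Hom K C, post t e = cls0 (id_hom C) & pre t e = cls0 (id_hom K)
  | _ => fun=> True
  end eta.
Proof.
by case=> //; exists (id_hom C); rewrite ?post_cls0 ?pre_cls0 comp_id_r.
Qed.

Lemma spliced_pre C n K (eta : Ext n C K) : spliced (cls0 (id_hom C)) eta ->
  forall X, (forall N i, M N -> (0 < i <= n)%N -> Ext_vanish i X N) ->
  forall e : Ext n X K, exists u : Hom X C, e = pre u eta.
Proof.
elim=> {n K eta} [|n K N K' i p S eta MN _ IH] X van e.
  by have [f <-] := cls0_surj e; exists f; rewrite pre_cls0 comp_id_l.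
have [e' <-] : exists e', delta S e' = e.
  by apply: vanish_delta; apply: van => //; rewrite leqnn.
have [|u ->] := IH X _ e'.
  by move=> N' j MN' /andP [j0 jn]; apply: van => //; rewrite j0 leqW.
by exists u; rewrite delta_pre.
Qed.

(** Ext^n(X, N) need not vanish for the last middle term; the killing condition, applied to the last
    inclusion [i], lets [e] lift along the connecting map instead. *)
Lemma spliced_pre_killed C n K (eta : Ext n C K) : spliced (cls0 (id_hom C)) eta ->
  forall X, (forall N i, M N -> (0 < i < n)%N -> Ext_vanish i X N) ->
  forall e : Ext n X K, (forall N (v : Hom K N), M N -> post v eta = 0 -> post v e = 0) ->
  exists u : Hom X C, e = pre u eta.
Proof.
case=> {n K eta} [|n K N K' i p S eta MN seta] X van e kill.
  by have [f <-] := cls0_surj e; exists f; rewrite pre_cls0 comp_id_l.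
have [e' <-] := post_eq0 S (kill N i MN (post_delta S eta)).
have [u ->] := spliced_pre seta (X := X) van e'.
by exists u; rewrite delta_pre.
Qed.

(** The vanishing of Ext^i(X, N) makes each connecting map injective. The start has positive degree
    because out of degree 0 this may fail. *)
Lemma spliced_pre_eq0 C n0 A0 (e0 : Ext n0.+1 C A0) n K (eta : Ext n C K) : spliced e0 eta ->
  (0 < n)%N /\ forall X (u : Hom X C),
  (forall N i, M N -> (0 < i < n)%N -> Ext_vanish i X N) -> pre u eta = 0 -> pre u e0 = 0.
Proof.
elim=> {n K eta} [|n K N K' i p S eta MN _ [n0_gt0 IH]]; split=> // X u van.
rewrite delta_pre => du; apply: IH => [N' j MN' /andP [j0 jn]|].
  by apply: van => //; rewrite j0 leqW.
case: n n0_gt0 eta van du => // n _ eta van; apply: vanish_delta_inj.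
by apply: van => //=.
Qed.

Hypothesis embedding : forall A : lmodType R, fin_gen A ->
  exists J (i : Hom A J), [/\ fin_gen J, injective_module J & injective i].

Lemma cosyzygy A : fin_gen A -> exists J A1 (i : Hom A J) (p : Hom J A1),
  [/\ ses i p, injective_module J, fin_gen J & fin_gen A1].
Proof.
move=> /embedding [J [i [fJ injJ injI]]]; have [A1 [p S]] := cokernel_exists injI.
exists J, A1, i, p; split=> //.
by have [_ surP _] := S; exact: fin_gen_surj fJ.
Qed.

(** The standard resolution does not show this, as [free_map] is not additive in its map. Shifting
    along injective embeddings reduces it to composition of maps in degree 0. *)
Lemma preD n X Y A (u v : Hom X Y) (e : Ext n Y A) : fin_gen A ->
  pre (u + v) e = pre u e + pre v e.
Proof.
elim: n A e => [|n IH] A e fA.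
  have [f <-] := cls0_surj e; rewrite !pre_cls0 comp_homDr.
  exact: (@clsD R 0 X A).
have [J [A1 [i [p [S injJ _ fA1]]]]] := cosyzygy fA.
have [e' <-] := inj_delta S injJ e.
by rewrite !delta_pre IH // deltaD.
Qed.

Lemma Ext_projective n P A : projective P -> fin_gen A -> Ext_vanish n.+1 P A.
Proof.
move=> prP; elim: n A => [|n IH] A fA e;
  have [J [A1 [i [p [S injJ _ fA1]]]]] := cosyzygy fA;
  have [e' <-] := inj_delta S injJ e; last by rewrite (IH A1 fA1 e') delta0.
have [h <-] := cls0_surj e'; have [_ surP _] := S.
have [g gE] := prP _ _ p h surP.
have <- : comp_hom p g = h by exact: homP.
by rewrite -post_cls0 delta_post.
Qed.

(** Embedding [A] in an injective [J] with cokernel [A1] lowers the degree and gives [h'] from [K']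
    to [A1]. It induces [h] on kernels once [comp_hom h' p] lifts to [J]; the obstruction lies in
    Ext^1(N, A). *)
Lemma spliced_post C n K (eta : Ext n C K) : spliced (cls0 (id_hom C)) eta ->
  forall A, fin_gen A -> (forall N i, M N -> (0 < i < n)%N -> Ext_vanish i N A) ->
  forall e : Ext n C A, (forall N (v : Hom N C), M N -> pre v eta = 0 -> pre v e = 0) ->
  exists h : Hom K A, e = post h eta.
Proof.
elim=> {n K eta} [|n K N K' i p S eta MN seta IH] A fA van e kill.
  by have [f <-] := cls0_surj e; exists f; rewrite post_cls0 comp_id_r.
have [J [A1 [j [q [T injJ _ fA1]]]]] := cosyzygy fA.
have [e' eE] := inj_delta T injJ e.
suff [h' e'E [g gE]] : exists2 h' : Hom K' A1, e' = post h' eta &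
    exists g : Hom N J, comp_hom q g = comp_hom h' p.
  have [h [_ hE]] := ses_map_left S T gE.
  by exists h; rewrite -eE e'E hE.
have kill' N' (v : Hom N' C) : M N' -> pre v (delta S eta) = 0 -> delta T (pre v e') = 0.
  by move=> MN' /kill; rewrite -eE delta_pre => ->.
(* For a single splice Ext^1(N, A) is not assumed to vanish. The obstruction is then the pullback of
   [e] along [comp_hom t p], which kills [delta S eta], so the killing condition applies. *)
case: n eta seta IH van e kill e' eE kill' => [|n] eta seta IH van e kill e' eE kill'.
  have [t tC tK] := spliced0_inv seta; have [f fE] := cls0_surj e'.
  exists (comp_hom f t).
    by rewrite post_comp tC post_cls0 comp_id_r fE.
  apply: (delta_cls0_eq0 (S := T)); rewrite -(kill' N (comp_hom t p) MN).
    by rewrite -fE pre_cls0 comp_homA.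
  rewrite delta_pre pre_comp tK pre_cls0 comp_id_l.
  by have := delta_post S (cls0 (id_hom N)); rewrite post_cls0 comp_id_r.
have [||h' ->] := IH A1 fA1 _ e'.
- move=> N' [//|m] MN' /andP [_ mn]; apply: (vanish_shift T injJ).
  exact: van.
- move=> N' v MN' v0; apply: (inj_delta_inj T injJ); apply: kill' => //.
  by rewrite delta_pre v0 delta0.
exists h' => //; apply: (vanish_lift T); exact: van.
Qed.

(** A homotopy is built along the splice: [m] extends [comp_hom j1 h] to [N] and induces [h'] on
    cokernels; a lift [g'] of [h'] corrects [m] to an extension [c] of [h] to [N], which lifts to
    [J] since Ext^1(N, A) = 0. *)
Lemma spliced_post_eq0 C n K (eta : Ext n C K) : spliced (cls0 (id_hom C)) eta ->
  forall A J A1 (j : Hom A J) (q : Hom J A1) (T : ses j q), injective_module J ->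
  fin_gen A1 -> (forall N i, M N -> (0 < i <= n)%N -> Ext_vanish i N A) ->
  forall h : Hom K A1, delta T (post h eta) = 0 -> exists g : Hom K J, comp_hom q g = h.
Proof.
elim=> {n K eta} [|n K N K' i p S eta MN _ IH] A J A1 j q T injJ fA1 van h h0.
  by apply: (delta_cls0_eq0 (S := T)); rewrite -h0 post_cls0 comp_id_r.
have [J1 [A2 [j1 [q1 [T1 injJ1 _ fA2]]]]] := cosyzygy fA1.
have [injI _ _] := S.
have [m mE] := injJ1 _ _ i (comp_hom j1 h) injI.
have [h' [h'p h'E]] := ses_map_right S T1 (homP (f := comp_hom m i) mE).
have [||g' g'E] := IH A1 J1 A2 j1 q1 T1 injJ1 fA2 _ h'.
- move=> N' [//|l] MN' /andP [_ ln]; apply: (vanish_shift T injJ); exact: van.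
- by rewrite h'E; exact: (inj_delta_inj T injJ).
have [x|c cE] := ses_lift (h := m - comp_hom g' p) T1.
  rewrite hom_subE linearB /= -h'p -g'E; exact: subrr.
have ci : comp_hom c i = h.
  apply: homP => x; have [injj1 _ _] := T1; apply: injj1.
  rewrite -[LHS]/(j1 (c (i x))) cE hom_subE -[m (i x)]/((m \o i) x) mE /=.
  by rewrite (ses_comp0 S) linear0 subr0.
have [|g gE] := vanish_lift T c; first exact: van.
by exists (comp_hom g i); rewrite comp_homA gE.
Qed.

End Splicing.
End DimensionShift.

(** * Resolutions by a cluster tilting subcategory *)

Section FreeModules.
Variable R : nzRingType.
Implicit Types U V : lmodType R.

Fact comb_is_linear U m (g : 'I_m -> U) : linear (fun v : 'rV[R]_m => \sum_i v 0 i *: g i).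
Proof.
move=> a u v; rewrite scaler_sumr -big_split; apply: eq_bigr => i _ /=.
by rewrite !mxE scalerDl scalerA.
Qed.
Definition comb_hom U m (g : 'I_m -> U) : Hom 'rV[R]_m U := mk_hom (comb_is_linear g).

Lemma rV_projective m : projective 'rV[R]_m.
Proof.
move=> U V g f surg.
pose s i := projT1 (cid (surg (f (delta_mx 0 i)))).
have sE i : g (s i) = f (delta_mx 0 i) by rewrite /s; case: cid.
exists (comb_hom s) => v; rewrite /= linear_sum [in RHS](row_sum_delta v) linear_sum.
by apply: eq_bigr => i _; rewrite !linearZ -sE.
Qed.

Lemma rV_fin_gen m : fin_gen 'rV[R]_m.
Proof.
by exists m, (fun i => delta_mx 0 i) => v; exists (fun i => v 0 i); exact: row_sum_delta.
Qed.

Lemma fin_gen_cover U : fin_gen U -> exists P (p : Hom P U),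
  [/\ projective P, fin_gen P & forall u, exists x, p x = u].
Proof.
move=> [m [g gE]]; exists 'rV[R]_m, (comb_hom g); split.
- exact: rV_projective.
- exact: rV_fin_gen.
move=> u; have [c ->] := gE u; exists (\row_i c i) => /=.
by apply: eq_bigr => i _; rewrite mxE.
Qed.

End FreeModules.

Section ClusterTiltingResolutions.
Variables (k : comNzRingType) (L : algType k) (HL : artin_algebra L).
Variables (n' : nat) (M : lmodType L -> Prop).
Notation n := n'.+1.
Hypothesis HM : cluster_tilting n M.
Implicit Types A B C K N X Y : lmodType L.

Let emb := injective_embedding HL.

Lemma tilt_fin_gen A : M A -> fin_gen A.
Proof. exact: (add_fin_gen (ct_additive HM)). Qed.

Lemma tilt_vanish A B i : M A -> M B -> (0 < i < n)%N -> Ext_vanish i A B.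
Proof. by move=> MA MB; have [_ /(_ A i MA)] := (ct_right_orth HM B).1 MB. Qed.

Lemma tilt_projective P : projective P -> fin_gen P -> M P.
Proof.
move=> prP fP; apply/(ct_left_orth HM); split=> // B [//|i] MB _.
exact/(Ext_projective emb prP)/tilt_fin_gen.
Qed.

Lemma tilt_injective J : injective_module J -> fin_gen J -> M J.
Proof.
move=> injJ fJ; apply/(ct_right_orth HM); split=> // B [//|i] MB _.
exact: Ext_injective.
Qed.

Definition vanish_from j K := forall B i, M B -> (0 < i < j)%N -> Ext_vanish i B K.
Definition vanish_to j X := forall B i, M B -> (0 < i < j)%N -> Ext_vanish i X B.

(** A right approximation is onto because [M] is generating. Maps from objects of [M] to [K] lift to
    [N], whence Ext^1(B, K') = 0; the higher groups are shifts of those of [K]. *)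
Lemma kernel_step j K : (j.+1 < n)%N -> fin_gen K -> vanish_from j.+1 K ->
  exists N K' (i : Hom K' N) (p : Hom N K),
  [/\ ses i p, M N, fin_gen K' & vanish_from j.+2 K'].
Proof.
move=> jn fK vK; have [[N [p [MN apx]]] _] := ct_functorially_finite HM fK.
have surP c : exists b, p b = c.
  have [B [f [MB surf]]] := ct_generating HM fK; have [b <-] := surf c.
  by have [h hE] := apx B f MB; exists (h b); rewrite hE.
have S := ses_ker surP; exists N, (ker p), (ker_incl p), p; split=> //.
  exact: (fin_gen_inj HL (f := ker_incl p) val_inj (tilt_fin_gen MN)).
move=> B [//|i] MB /andP [_ ij] e.
have [e' <-] : exists e', delta S e' = e.
  apply: vanish_delta; apply: tilt_vanish => //; apply/andP; split=> //.
  exact: (@leq_ltn_trans j.+1 i.+1 n ij jn).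
case: i e' {e} ij => [|i] e' ij; last by rewrite (vK B i.+1 MB ij e') delta0.
have [f <-] := cls0_surj e'; have [h /homP hE] := apx B f MB.
by have := delta_post S (cls0 h); rewrite post_cls0 -[comp_hom _ _]hE.
Qed.

(** A class comes from [f] into [B1], and [comp_hom f p] lifts to [g] from [N] to [J]. Once the
    induced map from [C] to [B] is extended to [N] and subtracted, [g] descends to a lift of [f]. *)
Lemma coker_vanish1 C N C' (i : Hom C N) (p : Hom N C') (S : ses i p) B : fin_gen B ->
  Ext_vanish 1 N B -> (forall a : Hom C B, exists b, comp_hom b i = a) -> Ext_vanish 1 C' B.
Proof.
move=> fB NB ext e; have [J [B1 [j [q [T injJ _ _]]]]] := cosyzygy emb fB.
have [e' <-] := inj_delta T injJ e; have [f <-] := cls0_surj e'.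
have [g gE] := vanish_lift T (comp_hom f p) NB.
have [a [aE _]] := ses_map_left S T gE; have [b bE] := ext a.
have [x|r rE] := ses_factor (h := g - comp_hom j b) S.
  by rewrite hom_subE -aE -bE subrr.
have <- : comp_hom q r = f.
  apply: homP => c; have [_ surP _] := S; have [x <-] := surP c.
  rewrite /= rE hom_subE linearB /= (ses_comp0 T) subr0.
  exact: (congr1 (fun h : Hom _ _ => h x) gE).
by rewrite -post_cls0 delta_post.
Qed.

Lemma coker_vanish C N C' (i : Hom C N) (p : Hom N C') (S : ses i p) l B : fin_gen B ->
  Ext_vanish l.+2 N B -> Ext_vanish l.+1 C B -> Ext_vanish l.+2 C' B.
Proof.
elim: l B => [|l IH] B fB NB CB e; have [J [B1 [j [q [T injJ _ fB1]]]]] := cosyzygy emb fB;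
  have [e' <-] := inj_delta T injJ e; last first.
  rewrite (IH B1 fB1 _ _ e') ?delta0 //; exact: (vanish_shift T).
rewrite (coker_vanish1 S fB1 _ _ e') ?delta0 //; first exact: (vanish_shift T).
(* The map [a] lifts to [J] as Ext^1(C, B) = 0, and the lift extends to [N] as [J] is injective. *)
move=> a; have [g gE] := vanish_lift T a CB; have [injI _ _] := S.
have [h hE] := injJ _ _ i g injI.
by exists (comp_hom q h); rewrite -comp_homA -gE; congr comp_hom; exact: homP.
Qed.

Lemma cokernel_step j C : (j.+1 < n)%N -> fin_gen C -> vanish_to j.+1 C ->
  exists N C' (i : Hom C N) (p : Hom N C'),
  [/\ ses i p, M N, fin_gen C' & vanish_to j.+2 C'].
Proof.
move=> jn fC vC; have [_ [N [i [MN apx]]]] := ct_functorially_finite HM fC.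
have injI : injective i.
  have [B [f [MB injf]]] := ct_cogenerating HM fC; have [h hE] := apx B f MB.
  by move=> x y xy; apply: injf; rewrite !hE /= xy.
have [C' [p S]] := cokernel_exists injI.
exists N, C', i, p; split=> //.
  by have [_ surP _] := S; apply: (fin_gen_surj surP); exact: tilt_fin_gen.
move=> B [//|[|l]] MB /andP [_ lj].
  apply: (coker_vanish1 S); first exact: tilt_fin_gen.
    by apply: tilt_vanish => //; apply/andP; split=> //; exact: (@leq_ltn_trans j.+1 1 n _ jn).
  by move=> a; have [h hE] := apx B a MB; exists h; exact/esym/homP.
apply: (coker_vanish S); first exact: tilt_fin_gen.
  by apply: tilt_vanish => //; apply/andP; split=> //; exact: (@leq_ltn_trans j.+1 l.+2 n lj jn).
exact: vC.
Qed.

Lemma kernel_chain Y A0 (e0 : Ext 1 Y A0) m : (m < n)%N -> fin_gen A0 ->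
  exists K (eta : Ext m.+1 Y K), [/\ spliced M e0 eta, fin_gen K & vanish_from m.+1 K].
Proof.
move=> mn fA0; elim: m mn => [_|m IH mn].
  by exists A0, e0; split=> // [|B [|i] //]; exact: spliced_base.
have [|K [eta [seta fK vK]]] := IH; first exact: ltnW.
have [N [K' [i [p [S MN fK' vK']]]]] := kernel_step mn fK vK.
by exists K', (delta S eta); split=> //; exact: spliced_step.
Qed.

(** A splice grows only at the end away from [C], so the first cokernel is taken before the
    recursive call, with [j] generalised. *)
Lemma cokernel_chain m j X : (j.+1 + m <= n)%N -> fin_gen X -> vanish_to j.+1 X ->
  exists C (eta : Ext m C X),
  [/\ spliced M (cls0 (id_hom C)) eta, fin_gen C & vanish_to (j.+1 + m) C].
Proof.
elim: m j X => [|m IH] j X jn fX vX.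
  by exists X, (cls0 (id_hom X)); rewrite addn0; split=> //; exact: spliced_base.
have [|N [C1 [i [p [S MN fC1 vC1]]]]] := @cokernel_step j X _ fX vX.
  by apply: leq_trans jn; rewrite addnS ltnS leq_addr.
have [|C [eta [seta fC vC]]] := IH j.+1 C1 _ fC1 vC1; first by rewrite addSnnS.
by exists C, (delta S eta); rewrite -addSnnS; split=> //; exact: spliced_step.
Qed.

(** The last three conditions serve in turn to find the kernel of the map sending [u] to u^*, to
    represent a transformation by some [u], and to show that its value on [eta] determines it. *)
Lemma projective_universal Y : M Y -> exists K (eta : Ext n Y K), [/\ M K,
  forall X (u : Hom X Y), M X -> pre u eta = 0 -> proj_null u,
  forall X (e : Ext n X K), M X ->
    (forall N (v : Hom K N), M N -> post v eta = 0 -> post v e = 0) ->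
    exists u, e = pre u eta &
  forall A (e : Ext n Y A), M A -> exists h, e = post h eta].
Proof.
move=> MY; have fY := tilt_fin_gen MY.
have [P [p [prP fP surP]]] := fin_gen_cover fY.
have S := ses_ker surP; have MP := tilt_projective prP fP.
have fA0 := fin_gen_inj HL (f := ker_incl p) val_inj fP.
pose e0 := delta S (cls0 (id_hom Y)).
have [K [eta [seta fK vK]]] := kernel_chain e0 (ltnSn n') fA0.
have s0 : spliced M (cls0 (id_hom Y)) eta.
  by apply: spliced_trans seta; apply: spliced_step => //; exact: spliced_base.
have MK : M K by apply/(ct_right_orth HM).
have null X (u : Hom X Y) : M X -> pre u eta = 0 -> exists g : Hom X P, comp_hom p g = u.
  move=> MX u0; apply: (delta_cls0_eq0 (S := S)).
  have [_ /(_ X u)] := spliced_pre_eq0 seta.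
  rewrite delta_pre pre_cls0 comp_id_l; apply=> // N i MN; exact: tilt_vanish.
exists K, eta; split=> //.
- move=> X u MX /(null X u MX) [g gE]; apply/asboolP; exists P => //.
  by exists g, p => x; rewrite -gE.
- move=> X e MX; apply: (spliced_pre_killed s0) => N i MN; exact: tilt_vanish.
move=> A e MA; have fA := tilt_fin_gen MA.
(* A map killing [eta] factors through [P], so it kills every [e] because Ext^n(P, A) = 0. *)
apply: (spliced_post emb s0) => // [N i MN|N v MN /(null N v MN) [g <-]].
  by move=> ?; exact: tilt_vanish.
by rewrite pre_comp (Ext_projective emb prP fA (pre p e)) raddf0.
Qed.

Lemma injective_universal X : M X -> exists C (eta : Ext n C X), [/\ M C,
  forall Y (f : Hom X Y), M Y -> post f eta = 0 -> inj_null f,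
  forall Y (e : Ext n C Y), M Y ->
    (forall N (v : Hom N C), M N -> pre v eta = 0 -> pre v e = 0) ->
    exists f, e = post f eta &
  forall A (e : Ext n A X), M A -> exists u, e = pre u eta].
Proof.
move=> MX; have fX := tilt_fin_gen MX.
have [I [C1 [i [p [S injI fI fC1]]]]] := cosyzygy emb fX.
have MI := tilt_injective injI fI.
have [|||C [eta [seta fC vC]]] := @cokernel_chain n' 0 C1.
- by [].
- by [].
- by move=> B [|l].
have MC : M C by apply/(ct_left_orth HM).
exists C, (delta S eta); split=> //.
- move=> Y f MY; have fY := tilt_fin_gen MY.
  (* The map [f'] induced by [f] on cokernels lifts to [J], and correcting [m] by this lift factors
     [f] through [I]. *)
  have [J [Y1 [j [q [T injJ _ fY1]]]]] := cosyzygy emb fY.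
  have [injIm _ _] := S; have [m mE] := injJ _ _ i (comp_hom j f) injIm.
  have [f' [f'p f'E]] := ses_map_right S T (homP (f := comp_hom m i) mE).
  rewrite -f'E => f'0.
  have [|g gE] := spliced_post_eq0 emb seta injJ fY1 _ f'0.
    by move=> N l MN ln; exact: tilt_vanish.
  have [x|c cE] := ses_lift (h := m - comp_hom g p) T.
    by rewrite hom_subE linearB /= -f'p -gE; exact: subrr.
  apply/asboolP; exists I => //; exists i, c => x; have [injj _ _] := T; apply: injj.
  rewrite -[RHS]/(j (c (i x))) cE hom_subE -[m (i x)]/((m \o i) x) mE /=.
  by rewrite (ses_comp0 S) linear0 subr0.
- move=> Y e MY; apply: (spliced_post emb (spliced_step S MI seta)) => [|N l MN].
    exact: tilt_fin_gen.
  by move=> ?; exact: tilt_vanish.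
move=> A e MA; have [e' <-] := inj_delta S injI e.
have [|u ->] := spliced_pre seta (X := A) _ e'.
  by move=> N l MN ln; exact: tilt_vanish.
by exists u; rewrite delta_pre.
Qed.

End ClusterTiltingResolutions.

(** * Natural transformations between Ext functors and the two isomorphisms *)

Section NaturalTransformations.
Variables (R : nzRingType) (M : lmodType R -> Prop) (n : nat).
Implicit Types A B X Y : lmodType R.

Lemma additive_ext (U V : zmodType) (f g : {additive U -> V}) : f =1 g -> f = g.
Proof.
case: f g => [f [[fB]]] [g [[gB]]] /= /funext fg.
by case: _ / fg in gB *; rewrite (Prop_irrelevance gB fB).
Qed.

Lemma Ext_cov_nat_ext Y X (s t : Ext_cov_nat M n Y X) :
  (forall A (MA : M A) e, cov_app s MA e = cov_app t MA e) -> s = t.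
Proof.
case: s t => [s sN] [t tN] /= st.
have {}st : s = t.
  by apply: functional_extensionality_dep => A; apply: functional_extensionality_dep => MA;
    exact/additive_ext/st.
by case: _ / st in tN *; rewrite (Prop_irrelevance tN sN).
Qed.

Lemma Ext_con_nat_ext X Y (s t : Ext_con_nat M n X Y) :
  (forall A (MA : M A) e, con_app s MA e = con_app t MA e) -> s = t.
Proof.
case: s t => [s sN] [t tN] /= st.
have {}st : s = t.
  by apply: functional_extensionality_dep => A; apply: functional_extensionality_dep => MA;
    exact/additive_ext/st.
by case: _ / st in tN *; rewrite (Prop_irrelevance tN sN).
Qed.

Definition pre_nat X Y (f : Hom X Y) : Ext_cov_nat M n Y X :=
  @ExtCovNat R M n Y X (fun A _ => Ext_map f (id_hom A))
    (fun A B _ _ h e => pre_post f h e).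

Definition post_nat X Y (f : Hom X Y) : Ext_con_nat M n X Y :=
  @ExtConNat R M n X Y (fun A _ => Ext_map (id_hom A) f)
    (fun A B _ _ h e => esym (pre_post h f e)).

End NaturalTransformations.

(** Natural transformations form no [zmodType], so the target has only an operation [add], and the
    kernel is described by equality of values. *)
Lemma quotient_bijection (V : zmodType) (N : zmodClosed V) (T : Type) (add : T -> T -> T)
    (F : V -> T) : (forall f g, F (f + g) = add (F f) (F g)) ->
  (forall f g, F f = F g <-> f - g \in N) -> (forall t, exists f, F f = t) ->
  exists Phi : Quotient.quot N -> T,
    (forall x y, Phi (x + y) = add (Phi x) (Phi y)) /\ bijective Phi.
Proof.
move=> FD FN Fsurj; pose Phi (x : Quotient.quot N) := F (repr x).
have PhiE f : Phi (\pi_(Quotient.quot N) f) = F f.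
  by apply/FN; rewrite Quotient.idealrBE reprK.
exists Phi; split=> [x y|].
  by rewrite -[x]reprK -[y]reprK -raddfD !PhiE FD.
pose G t := \pi_(Quotient.quot N) (projT1 (cid (Fsurj t))).
exists G => [x|t]; last by rewrite PhiE; case: cid.
rewrite -[RHS]reprK; apply/eqP; rewrite -Quotient.idealrBE; apply/FN.
by case: cid.
Qed.

Theorem theorem7p6 (k : comNzRingType) (L : algType k) (HL : artin_algebra L)
    (n : nat) (n_gt0 : (0 < n)%N)
    (M : lmodType L -> Prop) (HM : cluster_tilting n M)
    (X Y : lmodType L) (MX : M X) (MY : M Y) :
  (exists Phi : proj_stable_hom X Y -> Ext_cov_nat M n Y X,
     (forall f g, Phi (f + g) = Ext_cov_add (Phi f) (Phi g)) /\ bijective Phi) /\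
  (exists Phi : inj_stable_hom X Y -> Ext_con_nat M n X Y,
     (forall f g, Phi (f + g) = Ext_con_add (Phi f) (Phi g)) /\ bijective Phi).
Proof.
case: n n_gt0 HM => // n' _ HM; pose emb := injective_embedding HL; split.
- have [K [eta [MK null killed univ]]] := projective_universal HL HM MY.
  apply: (@quotient_bijection _ (GRing.ZmodClosed.clone (Hom X Y) (@proj_null L X Y) _)
           _ _ (@pre_nat L M n'.+1 X Y)) => [f g|f g|s].
  + by apply: Ext_cov_nat_ext => A MA e; rewrite /= (preD emb) //; exact: (tilt_fin_gen HM).
  (* Evaluation at [eta] shows that [f - g] kills [eta]; conversely, a map through a projective acts
     as zero on Ext^n. *)
  + split=> [fg|/asboolP [P prP [g1 [g2 gE]]]].
      apply: null => //; apply: (addIr (pre g eta)).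
      rewrite -(preD emb) ?subrK ?add0r; last exact: (tilt_fin_gen HM).
      exact: (congr1 (fun s => cov_app s MK eta) fg).
    apply: Ext_cov_nat_ext => A MA e; have fA := tilt_fin_gen HM MA.
    rewrite /= -[f in LHS](subrK g) (preD emb) // (homP (g := comp_hom g2 g1) gE).
    by rewrite pre_comp (Ext_projective emb prP fA (pre g2 e)) raddf0 add0r.
  (* By naturality, whatever kills [eta] kills its value under [s], which is therefore u^* eta; as
     every class is h_* eta, [s] is u^*. *)
  + have [|u uE] := killed X (cov_app s MK eta) MX.
      by move=> N v MN v0; rewrite -cov_natural v0 raddf0.
    exists u; apply: Ext_cov_nat_ext => A MA e; have [h ->] := univ A e MA.
    by rewrite (cov_natural s MK MA) uE; exact: pre_post.
- have [C [eta [MC null killed univ]]] := injective_universal HL HM MX.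
  apply: (@quotient_bijection _ (GRing.ZmodClosed.clone (Hom X Y) (@inj_null L X Y) _)
           _ _ (@post_nat L M n'.+1 X Y)) => [f g|f g|s].
  + by apply: Ext_con_nat_ext => A MA e; exact: postD.
  + split=> [fg|/asboolP [J injJ [g1 [g2 gE]]]].
      apply: null => //; apply: (addIr (post g eta)).
      rewrite -postD subrK add0r.
      exact: (congr1 (fun s => con_app s MC eta) fg).
    apply: Ext_con_nat_ext => A MA e.
    rewrite /= -[f in LHS](subrK g) postD (homP (g := comp_hom g2 g1) gE).
    by rewrite post_comp (Ext_injective injJ (post g1 e)) raddf0 add0r.
  + have [|u uE] := killed Y (con_app s MC eta) MY.
      by move=> N v MN v0; rewrite -con_natural v0 raddf0.
    exists u; apply: Ext_con_nat_ext => A MA e; have [h ->] := univ A e MA.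
    by rewrite (con_natural s MC MA) uE; exact/esym/pre_post.
Qed.
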